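(* There exists a constant $C > 1$ such that for every function $p = p(n) \in [0,1]$ with $p \geq C\log n / n$, the random graph $G \sim G(n,p)$ satisfies $\mathcal{C}_n(G) = \mathcal{C}(G)$ with high probability for odd $n$; that is, $\Pr[\mathcal{C}_n(G) = \mathcal{C}(G)] \to 1$ as $n \to \infty$ along odd integers.
   Context: $G(n,p)$ denotes the binomial (Erdős–Rényi) random graph on $n$ labelled vertices, where each pair of vertices forms an edge independently with probability $p$. $\log$ is the natural logarithm. For a graph $G=(V,E)$, the edge space $\mathcal{E}(G)$ is the $\mathbb{F}_2$-vector space of all subsets of $E$, with addition given by symmetric difference. The cycle space $\mathcal{C}(G) \subseteq \mathcal{E}(G)$ is the subspace spanned by (the edge sets of) all, not necessarily induced, cycles in $G$. For an integer $k$, $\mathcal{C}_k(G) \subseteq \mathcal{C}(G)$ is the subspace spanned by the edge sets of all cycles in $G$ of length exactly $k$. Thus, if $G$ has $n$ vertices, $\mathcal{C}_n(G)$ is the subspace spanned by the Hamilton cycles of $G$. *)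

(* Defs.v *)
From HB Require Import structures.
From mathcomp Require Import all_boot all_order all_algebra.
From mathcomp Require Import all_classical all_reals all_analysis.
Import Order.TTheory GRing.Theory Num.Theory.
Import numFieldNormedType.Exports.
Set Implicit Arguments.
Unset Strict Implicit.
Unset Printing Implicit Defensive.
Local Open Scope ring_scope.

Definition edge (n : nat) : finType := {e : {set 'I_n} | #|e| == 2%N}.

(* A simple graph on the vertex set 'I_n is identified with its edge set. *)
Definition graph (n : nat) : finType := {set edge n}.

Definition adj (n : nat) (G : graph n) : rel 'I_n :=
  fun x y => [exists e in G, val e == [set x; y]].

(* A cycle is given by the cyclic sequence of its distinct vertices; it need
   not be induced. *)
Definition is_cycle (n : nat) (G : graph n) (c : seq 'I_n) : bool :=
  (2 < size c)%N && ucycleb (adj G) c.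

Definition cycle_edges (n : nat) (c : seq 'I_n) : {set edge n} :=
  [set e : edge n | [exists x in c, val e == [set x; next c x]]].

Definition is_kcycle_set (n : nat) (G : graph n) (k : nat)
    (D : {set edge n}) : bool :=
  [exists c : k.-tuple 'I_n, is_cycle G c && (D == cycle_edges c)].

(* The edge spaces of all graphs on 'I_n live in the edge space of the complete
   graph, where a set of edges is represented by its indicator function. *)
Definition edge_vect (n : nat) : vectType 'F_2 := {ffun edge n -> ('F_2)^o}.

Definition chi (n : nat) (D : {set edge n}) : edge_vect n :=
  [ffun e => (e \in D)%:R].

Definition edge_space (n : nat) (G : graph n) : {vspace edge_vect n} :=
  <<[seq chi D | D : {set edge n} in powerset G]>>%VS.

(* The vertices of a cycle are distinct, so its length is at most n. *)
Definition cycle_space (n : nat) (G : graph n) : {vspace edge_vect n} :=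
  <<[seq chi D | D : {set edge n} in
      [pred D | [exists k : 'I_n.+1, is_kcycle_set G k D]]]>>%VS.

Definition kcycle_space (k n : nat) (G : graph n) : {vspace edge_vect n} :=
  <<[seq chi D | D : {set edge n} in [pred D | is_kcycle_set G k D]]>>%VS.

Definition gnp_mass (R : realType) (n : nat) (p : R) (G : graph n) : R :=
  \prod_(e : edge n) (if e \in G then p else 1 - p).

Definition gnp_prob (R : realType) (n : nat) (p : R) (A : pred (graph n)) : R :=
  \sum_(G : graph n | A G) gnp_mass p G.

Lemma chiD (n : nat) (D T : {set edge n}) :
  chi D + chi T = chi ((D :\: T) :|: (T :\: D)).
Proof.
apply/ffunP => e; rewrite !ffunE !inE.
by case: (e \in D); case: (e \in T); apply/val_inj.
Qed.

Lemma chi_inj (n : nat) : injective (@chi n).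
Proof.
move=> D T /ffunP eST; apply/setP => e; have := eST e; rewrite !ffunE.
by case: (e \in D); case: (e \in T).
Qed.

Lemma mem_edge_space (n : nat) (G : graph n) (v : edge_vect n) :
  reflect (exists2 D : {set edge n}, D \subset G & v = chi D)
          (v \in edge_space G).
Proof.
apply: (iffP idP) => [|[D sSG ->]]; last first.
  by apply/memv_span/fintype.imageP; exists D; rewrite ?powersetE.
move=> /(coord_span (X := in_tuple _)) ->.
apply: (big_ind (fun v => exists2 D : {set edge n}, D \subset G & v = chi D)).
- exists finset.set0; first exact: finset.sub0set.
  by apply/ffunP => e; rewrite !ffunE inE.
- move=> _ _ [D sS ->] [T sT ->]; exists ((D :\: T) :|: (T :\: D)).
    by rewrite finset.subUset !(fintype.subset_trans (finset.subsetDl _ _)).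
  exact: chiD.
move=> i _; set a := coord _ _ _.
have /fintype.imageP[D] := mem_nth (0 : edge_vect n) (ltn_ord i).
rewrite powersetE => sSG /= ->.
have [->|a0] := eqVneq a 0.
  exists finset.set0; first exact: finset.sub0set.
  by rewrite scale0r; apply/ffunP => e; rewrite !ffunE inE.
exists D => //; suff -> : a = 1 by rewrite scale1r.
by case: a a0 => [[|[|[]]]] // ? _; apply/val_inj.
Qed.

Lemma cycle_edges_sub (n : nat) (G : graph n) (c : seq 'I_n) :
  is_cycle G c -> cycle_edges c \subset G.
Proof.
move=> /andP[_ /andP[cG _]]; apply/fintype.subsetP => e; rewrite inE.
move=> /existsP[x /andP[xc /eqP ve]].
have /existsP[f /andP[fG /eqP vf]] := next_cycle cG xc.
by rewrite (_ : e = f) //; apply: val_inj; rewrite ve vf.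
Qed.

Lemma mem_cycle_space (n : nat) (G : graph n) (c : seq 'I_n) :
  is_cycle G c -> chi (cycle_edges c) \in cycle_space G.
Proof.
move=> cG; apply/memv_span/fintype.imageP; exists (cycle_edges c) => //.
have szc : (size c < n.+1)%N.
  have /andP[_ /andP[_ /card_uniqP <-]] := cG.
  by rewrite ltnS -[leqRHS]card_ord max_card.
apply/existsP; exists (Ordinal szc); apply/existsP; exists (in_tuple c).
by rewrite cG /=.
Qed.

Lemma gnp_mass_ge0 (R : realType) (n : nat) (p : R) (G : graph n) :
  0 <= p <= 1 -> 0 <= gnp_mass p G.
Proof.
move=> /andP[p0 p1]; apply: prodr_ge0 => e _.
by case: ifP; rewrite ?subr_ge0.
Qed.

Lemma gnp_probT (R : realType) (n : nat) (p : R) :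
  gnp_prob (n := n) p predT = 1.
Proof.
have := @bigA_distr R 0 1 *%R +%R (edge n) (fun=> p) (fun=> 1 - p).
rewrite big1 => [->|e _]; last by rewrite /= addrC subrK.
exact: eq_bigl.
Qed.

(* Main.v *)
(* Work modulo the span of the Hamilton cycles, and show that every cycle
   vanishes there.

   Short even cycles vanish.  Let v_0 ... v_(2k-1) be an even cycle of length
   O(log n).  Join v_i to v_(2k-i) for 0 < i < k by disjoint short paths, and
   v_k to v_0 by a path through all the remaining vertices.  The two alternating
   perfect matchings of the cycle complete these paths to two Hamilton cycles,
   whose sum is the given cycle.

   All cycles vanish.  Let g be the class of an edge.  Since any two vertices
   are joined by short paths of both parities that avoid a given small set, the
   vanishing of g on short even cycles gives a potential a and a constant tau
   with g(uv) = a(u) + a(v) + tau.  The sum of g over a cycle of length k is then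
   k tau, and a Hamilton cycle gives n tau = 0, so tau = 0 as n is odd.

   The disjoint short paths come from the Friedman--Pippenger method, which
   embeds binary trees greedily in an expander.  The long path comes from Posa
   rotations: fix a small set V2 of vertices.  The edges touching V2 make the
   graph an expander, so whenever the long path is missing, a positive
   proportion of the pairs outside V2 are boosters.  Edges outside V2 are
   independent of those touching V2, so the probability that no booster is
   present is small enough for a union bound over all sets of remaining
   vertices, all ends of the path, and all choices of the boosters added so far. *)

From HB Require Import structures.
From mathcomp Require Import all_boot all_order all_algebra zify boolp reals.
Require Import Defs.
Set Implicit Arguments.
Unset Strict Implicit.
Unset Printing Implicit Defensive.

(** * Paths and the Friedman--Pippenger extension lemma *)

Section Steps.
Variable T : Type.
Implicit Types (s t : seq T) (e : rel T).

Definition steps s := zip s (behead s).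

Lemma steps_cat s x t : steps (s ++ x :: t) = steps (rcons s x) ++ steps (x :: t).
Proof. by elim: s => [|a [|b s] IH] //=; congr cons; exact: IH. Qed.

Lemma steps_rcons2 s x y : steps (rcons (rcons s x) y) = rcons (steps (rcons s x)) (x, y).
Proof. by rewrite -[in LHS]cats1 cat_rcons steps_cat cats1. Qed.

Lemma steps_rev s : steps (rev s) = rev [seq (p.2, p.1) | p <- steps s].
Proof.
elim: s => [|a [|b s] IH] //.
by rewrite 2!rev_cons steps_rcons2 -rev_cons IH [steps (a :: _)]/= map_cons rev_cons.
Qed.

Lemma sorted_steps e s : sorted e s = all (fun p => e p.1 p.2) (steps s).
Proof. by elim: s => [|a [|b s] IH] //=; rewrite -IH. Qed.

Lemma sorted_cat_cons e s x t : sorted e (s ++ x :: t) = sorted e (rcons s x) && sorted e (x :: t).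
Proof. by rewrite !sorted_steps steps_cat all_cat. Qed.

Lemma sorted_rev_sym e s : symmetric e -> sorted e (rev s) = sorted e s.
Proof. by move=> e_sym; rewrite rev_sorted; apply: eq_sorted => x y; rewrite e_sym. Qed.

End Steps.

Lemma mem_steps (T : eqType) (a b : T) s : (a, b) \in steps s -> (a \in s) && (b \in s).
Proof.
elim: s => [|x [|y s] IH] //; rewrite inE => /orP[/eqP[-> ->]|/IH /andP[h1 h2]].
  by rewrite !inE !eqxx orbT.
by rewrite !(in_cons x) h1 h2 !orbT.
Qed.

Section Expansion.
Variables (V : finType) (N : V -> {set V}) (m : nat).
Implicit Types (X U : {set V}) (d : V -> nat) (s : seq (V * V)).

Definition nb U := \bigcup_(u in U) N u.

Lemma nbU U1 U2 : nb (U1 :|: U2) = nb U1 :|: nb U2.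
Proof. by rewrite /nb bigcup_setU. Qed.

Lemma nb1 u : nb [set u] = N u.
Proof. by rewrite /nb big_set1. Qed.

Lemma nbS U1 U2 : U1 \subset U2 -> nb U1 \subset nb U2.
Proof.
move=> sU; apply/bigcupsP => u uU1; apply: bigcup_sup; exact: (subsetP sU).
Qed.

(* Friedman--Pippenger invariant of a forest grown inside the graph: [X] are
   the vertices already used, [d u] is the number of children of [u], and
   every vertex is to have two children in the end. *)
Definition extendable X d :=
  forall U, #|U| <= m.*2 -> (#|U|).*2 <= #|nb U :\: X| + \sum_(u in U) d u.

(** Strict slack on the upper half of the range of sizes. It keeps every tight set below [m], so
    that the union of two tight sets still has at most [2m] elements. *)
Definition wide X := forall U, m <= #|U| <= m.*2 -> (#|U|).*2 < #|nb U :\: X|.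

Lemma extend X d u : 0 < m -> wide X -> extendable X d -> d u < 2 ->
  exists2 w, w \in N u :\: X & extendable (w |: X) (fun v => d v + (v == u)).
Proof.
move=> m0 wX eX du.
suff /exists_inP[w wN /forallP ew] : [exists w in N u :\: X, [forall U : {set V},
    (#|U| <= m.*2) ==> ((#|U|).*2 <= #|nb U :\: (w |: X)| +
      \sum_(v in U) (d v + (v == u)))]].
  by exists w => // U; have /implyP := ew U.
(* [T] is a largest tight set avoiding [u]; when no [w] works, it absorbs all
   the witnesses of failure, and then [u |: T] violates the invariant. *)
pose tight U := (#|U| <= m.*2) && (#|nb U :\: X| + \sum_(v in U) d v == (#|U|).*2).
have tight_lt U : tight U -> #|U| < m.
  case/andP => Um /eqP Ut; rewrite ltnNge; apply/negP => mU.
  have := wX U; rewrite mU Um => /(_ isT); lia.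
(* The free neighbourhood size is submodular and the sum of [d] is modular, so the invariant for the
   union and for the intersection must both hold with equality. *)
have tightU U1 U2 : tight U1 -> tight U2 -> tight (U1 :|: U2).
  move=> t1 t2; have := tight_lt _ t1; have := tight_lt _ t2.
  case/andP: t1 => c1 /eqP e1; case/andP: t2 => c2 /eqP e2 l2 l1.
  have cU := cardsUI U1 U2; have mU : #|U1 :|: U2| <= m.*2 by lia.
  rewrite /tight mU /=.
  have mI : #|U1 :&: U2| <= m.*2 by have := subset_leq_card (subsetIl U1 U2); lia.
  have hU := eX _ mU; have hI := eX _ mI.
  have dU : \sum_(v in U1 :|: U2) d v + \sum_(v in U1 :&: U2) d v =
            \sum_(v in U1) d v + \sum_(v in U2) d v.
    rewrite !(big_mkcond (fun v => v \in _)) -!big_split.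
    by apply: eq_bigr => v _; rewrite !inE; case: (v \in U1); case: (v \in U2); rewrite //= addn0.
  have nU : #|nb (U1 :|: U2) :\: X| + #|nb (U1 :&: U2) :\: X| <=
            #|nb U1 :\: X| + #|nb U2 :\: X|.
    rewrite -[leqRHS]cardsUI -setDUl -nbU leq_add2l; apply: subset_leq_card.
    rewrite subsetI !setSD // nbS //; [exact: subsetIr | exact: subsetIl].
  lia.
apply: contraT; rewrite negb_exists_in => /forall_inP bad.
pose P U := tight U && (u \notin U).
have t0 : P finset.set0.
  rewrite /P; by rewrite /tight /nb !big_set0 cards0 set0D cards0 inE.
case: (arg_maxnP (fun U : {set V} => #|U|) t0) => T /andP[Tt uT] Tmax {t0}.
(* Reserving [w] costs a set at most one free neighbour, and a set containing [u] is repaid by the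
   new child. A witness of failure is therefore tight, avoids [u] and has [w] as a free neighbour;
   by maximality it lies inside [T]. *)
have sub : N u :\: X \subset nb T.
  apply/subsetP => w wN.
  have /forallPn[U] := bad _ wN; rewrite negb_imply -ltnNge big_split /=.
  case/andP=> Um; have eU := eX _ Um.
  have cw : #|nb U :\: X| = (w \in nb U :\: X) + #|nb U :\: (w |: X)|.
    by rewrite (cardsD1 w) setDDl (setUC X).
  have cw1 := leq_b1 (w \in nb U :\: X).
  have [uU|uU] := boolP (u \in U).
    by rewrite [X in _ + (_ + X)](bigD1 u) //= eqxx; lia.
  rewrite [X in _ + (_ + X)]big1 => [|v vU]; last first.
    by apply/eqP; rewrite eqb0; apply: contraNneq uU => <-.
  rewrite addn0 => Ud.
  have wU : w \in nb U :\: X by move: cw; case: (w \in _) => //; lia.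
  rewrite wU in cw.
  have tU : tight U by rewrite /tight Um /=; lia.
  have := Tmax (T :|: U); rewrite /P tightU //= !inE negb_or uT uU => /(_ isT) le.
  have E : T = T :|: U by apply/eqP; rewrite eqEcard subsetUl.
  by rewrite E nbU inE; case/setDP: wU => ->; rewrite orbT.
(* Passing from [T] to [u |: T] adds no free neighbour, raises the required number by two, and
   raises the sum of [d] only by [d u < 2]. *)
have uTm : #|u |: T| <= m.*2 by rewrite cardsU1 uT; have := tight_lt _ Tt; lia.
have := eX _ uTm.
have sub' : N u :\: X \subset nb T :\: X.
  by apply/subsetP => z zN; rewrite inE (subsetP sub) // andbT; case/setDP: zN.
rewrite cardsU1 uT nbU nb1 setDUl (setUidPr sub').
rewrite big_setU1 //=.
by case/andP: Tt => _ /eqP; lia.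
Qed.

(** A set containing [u] loses one child in the sum but regains [w] as a free neighbour; other sets
    can only gain. *)
Lemma retract X d d' w u : w \in N u :\: X ->
  (forall v, d' v = d v + (v == u)) -> extendable (w |: X) d' -> extendable X d.
Proof.
move=> wN dd' eX U Um; have := eX _ Um.
rewrite (eq_bigr _ (fun v _ => dd' v)) big_split /=.
have cw : #|nb U :\: X| = (w \in nb U :\: X) + #|nb U :\: (w |: X)|.
  by rewrite (cardsD1 w) setDDl (setUC X).
have [uU|uU] := boolP (u \in U); last first.
  rewrite [X in _ + (_ + X)]big1 => [|v vU]; first by lia.
  by apply/eqP; rewrite eqb0; apply: contraNneq uU => <-.
have wU : w \in nb U :\: X.
  case/setDP: wN => wN wX; rewrite inE wX /=; apply/bigcupP; by exists u.
rewrite wU in cw; rewrite [X in _ + (_ + X)](bigD1 u) //= eqxx [X in _ + (_ + (_ + X))]big1 => [|v /andP[_ /negbTE ->] //].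
lia.
Qed.

End Expansion.

(** * Linking pairs of vertices *)

Lemma unzip2_steps (T : Type) (x : T) s : unzip2 (steps (x :: s)) = s.
Proof. by elim: s x => [|y s IH] x //; rewrite -[in RHS](IH y). Qed.

Lemma unzip1_steps (T : Type) (x : T) s : unzip1 (steps (x :: s)) = belast x s.
Proof. by elim: s x => [|y s IH] x //; rewrite -[RHS]/(x :: belast y s) -IH. Qed.

Section Linking.
Variables (V : finType) (N : V -> {set V}) (m B : nat) (e : rel V).
Implicit Types (X U : {set V}) (s r : seq (V * V)).

(** The list [s] records pairs (parent, child) of a forest whose roots lie in [X]. *)
Definition used X s := X :|: [set v in unzip2 s].
Definition kids s v := count (fun p => p.1 == v) s.

Definition forest X s :=
  uniq (unzip2 s) && all (fun p => [&& p.2 \in N p.1, p.2 \notin X & p.1 \in used X s]) s.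

Definition growable X s := extendable N m (used X s) (kids s).

Lemma usedE X s v : (v \in used X s) = (v \in X) || (v \in unzip2 s).
Proof. by rewrite /used !inE. Qed.

Lemma used_cons X s u w : used X ((u, w) :: s) = w |: used X s.
Proof. by apply/setP => v; rewrite in_setU1 !usedE /= inE orbCA. Qed.

Lemma card_used X s : #|used X s| <= #|X| + size s.
Proof.
rewrite (leq_trans (leq_card_setU _ _)) // leq_add2l.
by rewrite cardsE (leq_trans (card_size _)) // size_map.
Qed.

Lemma kids_eq0 s v : (v \notin unzip1 s) -> kids s v = 0.
Proof.
move=> vs; apply/eqP; rewrite -leqn0 leqNgt -has_count; apply: contra vs.
by case/hasP => p ps /eqP <-; apply: map_f.
Qed.

Lemma kids_cat s1 s2 v : kids (s1 ++ s2) v = kids s1 v + kids s2 v.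
Proof. exact: count_cat. Qed.

Lemma forest_parent X s v : forest X s -> v \in unzip1 s -> v \in used X s.
Proof. by case/andP=> _ /allP a /mapP[p /a /and3P[_ _ ps] ->]. Qed.

Lemma forest_kid X s v : forest X s -> v \in unzip2 s -> (v \notin X) && [exists u, v \in N u].
Proof.
case/andP=> _ /allP a /mapP[p /a /and3P[pN pX _] ->] /=.
by rewrite pX; apply/existsP; exists p.1.
Qed.

Lemma perm_growable X s s' : perm_eq s s' -> growable X s -> growable X s'.
Proof.
move=> ss' g U Um; have := g U Um.
have -> : used X s' = used X s.
  by apply/setP => v; rewrite !usedE (perm_mem (perm_map snd ss')).
by rewrite (eq_bigr (kids s')) // => v _; apply/permP.
Qed.

(* Only the freshness of the children matters: vertices can be released in any
   order, whether or not they have children themselves. *)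
Lemma growable_catr X r s : forest X (r ++ s) -> growable X (r ++ s) -> growable X s.
Proof.
case/andP; rewrite /unzip2 map_cat all_cat => u2 /andP[a _].
have {a} : all (fun p => (p.2 \in N p.1) && (p.2 \notin X)) r.
  by apply: sub_all a => p /and3P[-> ->].
elim: r u2 => [|[u w] r IH] //= /andP[w_new u2] /andP[/andP[/= wN wX] a] g.
apply: IH => //; apply: (@retract _ N m _ _ (kids ((u, w) :: r ++ s)) w u) => [|v|].
- by rewrite inE wN andbT usedE negb_or wX /unzip2 map_cat.
- by rewrite /kids /= addnC eq_sym.
by rewrite -(used_cons X (r ++ s) u w).
Qed.

(** The dropped pairs are permuted to the front and then released. *)
Lemma prune X s s' : forest X s -> growable X s -> uniq s' -> {subset s' <= s} -> growable X s'.
Proof.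
move=> fs gs us' ss'.
have us : uniq s by case/andP: fs => /map_uniq.
have p : perm_eq s ([seq p <- s | p \notin s'] ++ s').
  apply: uniq_perm => //.
    rewrite cat_uniq filter_uniq //= us' andbT; apply/hasPn => x xs'.
    by rewrite mem_filter xs'.
  move=> x; rewrite mem_cat mem_filter; have [/ss' ->|] := boolP (x \in s') => //=.
  by rewrite orbF.
apply: growable_catr (perm_growable p gs).
case/andP: fs => u2 a; apply/andP; split.
  by rewrite (perm_uniq (perm_map snd (_ : perm_eq _ s))) // perm_sym.
apply/allP => x; rewrite -(perm_mem p) => /(allP a) /and3P[-> -> /=].
by rewrite !usedE (perm_mem (perm_map snd p)).
Qed.

Hypothesis m_gt0 : 0 < m.
Hypothesis wideB : forall X, #|X| <= B -> wide N m X.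

Lemma grow1 X s u : forest X s -> growable X s -> u \in used X s -> kids s u < 2 ->
  #|X| + size s <= B ->
  exists w, [/\ w \notin used X s, w \in N u, forest X ((u, w) :: s) & growable X ((u, w) :: s)].
Proof.
move=> fs gs us k sB.
have [w /setDP[wN wX] g] := extend m_gt0 (wideB (leq_trans (card_used X s) sB)) gs k.
exists w; split=> //.
  case/andP: fs => u2 a; apply/andP; split=> /=.
    by rewrite u2 andbT; move: wX; rewrite usedE negb_or => /andP[].
  rewrite wN; move: (wX); rewrite !usedE negb_or => /andP[-> _] /=.
  move: us; rewrite usedE /= inE => /orP[->|us] /=; last rewrite us !orbT /=.
    apply: sub_all a => p /and3P[-> -> /=]; rewrite !usedE inE => /orP[->|->] //.
    by rewrite !orbT.
  apply: sub_all a => p /and3P[-> -> /=]; rewrite !usedE inE => /orP[->|->] //.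
  by rewrite !orbT.
move=> U Um; have := g U Um.
rewrite used_cons; congr (_ <= _ + _); apply: eq_bigr => v _.
by rewrite /kids /= addnC eq_sym.
Qed.

Lemma used_catr X r s : {subset used X s <= used X (r ++ s)}.
Proof. by move=> v; rewrite !usedE /unzip2 map_cat mem_cat => /orP[->|->]; rewrite ?orbT. Qed.

Lemma forest_catP X r s v : forest X (r ++ s) -> v \in unzip2 r -> v \notin used X s.
Proof.
move=> f vr; have vrs : v \in unzip2 (r ++ s) by rewrite /unzip2 map_cat mem_cat vr.
have /andP[vX _] := forest_kid f vrs; rewrite usedE (negbTE vX) /=.
case/andP: f => + _; rewrite /unzip2 map_cat cat_uniq => /and3P[_ /hasPn h _].
by apply/negP => /h /=; rewrite vr.
Qed.

Lemma grow_level X s F : forest X s -> growable X s -> uniq F -> {subset F <= used X s} ->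
  (forall u, u \in F -> kids s u = 0) -> #|X| + size s + (size F).*2 <= B ->
  exists r, [/\ forest X (r ++ s), growable X (r ++ s), size r = (size F).*2 &
                {subset unzip1 r <= F}].
Proof.
move=> fs gs; elim: F => [|u F IH] /=; first by exists [::].
move=> /andP[uF uqF] sF k sB.
have [v vF|v vF||r [fr gr zr sr]] := IH uqF.
- by apply: sF; rewrite inE vF orbT.
- by apply: k; rewrite inE vF orbT.
- by set z := size F in sB *; lia.
have us : u \in used X s by apply: sF; rewrite inE eqxx.
have k0 : kids (r ++ s) u = 0.
  by rewrite kids_cat k ?inE ?eqxx // kids_eq0 //; apply: contra uF => /sr.
have [|||w1 [w1n w1N f1 g1]] := grow1 fr gr (u := u).
- exact: used_catr us.
- by rewrite k0.
- by rewrite size_cat zr; set z := size F in sB *; lia.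
have [|||w2 [w2n w2N f2 g2]] := grow1 f1 g1 (u := u).
- by apply: (@used_catr _ [:: _]); apply: used_catr.
- by rewrite /kids /= eqxx -/(kids (r ++ s) u) k0.
- by rewrite /= size_cat zr; set z := size F in sB *; lia.
exists [:: (u, w2), (u, w1) & r]; split=> //=; first by rewrite zr.
by move=> v; rewrite !inE => /or3P[->|->|/sr ->]; rewrite ?orbT.
Qed.

(** The complete binary tree of depth [t] below [u], built level by level: [r] holds its pairs, [F]
    its leaves, and [q] the branch to a leaf. The leaves are still childless, so the next level can
    be grown. *)
Lemma grow_tree X s u t : forest X s -> growable X s -> u \in used X s -> kids s u = 0 ->
  #|X| + size s + 2 ^ t.+1 <= B ->
  exists r F, [/\ forest X (r ++ s), growable X (r ++ s), size r + 2 <= 2 ^ t.+1,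
    {subset unzip1 r <= u :: unzip2 r} &
    [/\ uniq F, size F = 2 ^ t, {subset F <= u :: unzip2 r},
        forall w, w \in F -> kids (r ++ s) w = 0 &
        forall w, w \in F -> exists q, [/\ size q = t, last u q = w, uniq q &
          {subset steps (u :: q) <= r}]]].
Proof.
move=> fs gs us k; elim: t => [|t IH] sB.
  exists [::], [:: u]; split=> //; split=> //.
    by move=> w; rewrite inE => /eqP ->.
  by move=> w; rewrite inE => /eqP ->; exists [::].
have e2 : 2 ^ t.+2 = (2 ^ t.+1).*2 by rewrite expnS mul2n.
have e1 : 2 ^ t.+1 = (2 ^ t).*2 by rewrite expnS mul2n.
have [|r [F [fr gr zr pr [uF zF sF kF qF]]]] := IH; first by lia.
have [||r' [fr' gr' zr' pr']] := grow_level fr gr uF _ kF.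
- move=> v /sF; rewrite inE => /orP[/eqP ->|vr]; first exact: used_catr.
  by rewrite usedE /unzip2 map_cat mem_cat vr orbT.
- by rewrite size_cat zF; lia.
have new w : w \in unzip2 r' -> w \notin used X (r ++ s) by exact: forest_catP.
exists (r' ++ r), (unzip2 r'); rewrite -catA; split=> //.
- by rewrite size_cat zr' zF; lia.
- move=> v; rewrite /unzip1 /unzip2 !map_cat inE !mem_cat => /orP[/pr' /sF|/pr].
    by rewrite inE => /orP[->|->]; rewrite ?orbT.
  by rewrite inE => /orP[->|->]; rewrite ?orbT.
split.
- by case/andP: fr'; rewrite /unzip2 map_cat cat_uniq => /andP[].
- by rewrite size_map zr' zF e1.
- by move=> w wr'; rewrite inE /unzip2 map_cat mem_cat wr' orbT.
- move=> w /[dup] wr' /new w_new; rewrite kids_cat !kids_eq0 //.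
    by apply: contra w_new; exact: forest_parent.
  apply: contra w_new => /pr' /sF; rewrite inE => /orP[/eqP ->|vr]; first exact: used_catr.
  by rewrite usedE /unzip2 map_cat mem_cat vr orbT.
move=> w wr'; case/mapP: (wr') => -[f w'] /= fw' ww'; subst w'.
have /qF[q [zq lq uq sq]] : f \in F by apply: pr'; exact: (map_f fst fw').
exists (rcons q w); split.
- by rewrite size_rcons zq.
- by rewrite last_rcons.
- rewrite rcons_uniq uq andbT; apply: contra (new _ wr') => wq.
  rewrite usedE /unzip2 map_cat mem_cat -!/(unzip2 _).
  suff -> : w \in unzip2 r by rewrite orbT.
  move: wq; rewrite -{1}(unzip2_steps u q) => /mapP[p /sq pr0 ->]; exact: map_f.
move=> p; rewrite -rcons_cons lastI lq steps_rcons2 mem_rcons inE mem_cat -lq -lastI.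
by rewrite lq => /orP[/eqP ->|/sq ->]; rewrite ?fw' ?orbT.
Qed.

Hypothesis e_sym : symmetric e.
Hypothesis N_e : forall u w, w \in N u -> e u w.
Hypothesis joint : forall A A' : {set V}, [disjoint A & A'] -> m <= #|A| -> m <= #|A'| ->
  exists2 u, u \in A & exists2 w, w \in A' & e u w.

Lemma sorted_forest X s q : forest X s -> {subset steps q <= s} -> sorted e q.
Proof.
case/andP=> _ /allP a sq; rewrite sorted_steps; apply/allP => p /sq /a /and3P[pN _ _].
exact: N_e.
Qed.

(** Two trees with at least [m] leaves each are joined by an edge between their leaves. The interior
    of the resulting path has exactly [t1 + t2] vertices, so its parity can be prescribed. The last
    clause keeps the ends of later links childless. *)
Lemma link X s a b t1 t2 : a \in X -> b \in X -> a != b ->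
  forest X s -> growable X s -> kids s a = 0 -> kids s b = 0 ->
  0 < t1 -> 0 < t2 -> m <= 2 ^ t1 -> m <= 2 ^ t2 ->
  #|X| + size s + 2 ^ t1.+1 + 2 ^ t2.+1 <= B ->
  exists q s', [/\ size q = t1 + t2, sorted e (a :: rcons q b),
    forest X s' & growable X s'] /\
    [/\ perm_eq (unzip2 s') (q ++ unzip2 s) &
    forall v, v \in X -> v != a -> v != b -> kids s' v = kids s v].
Proof.
move=> aX bX ab fs gs ka kb t1_gt0 t2_gt0 mt1 mt2 sB.
have as_ : a \in used X s by rewrite usedE aX.
have [|r1 [F1 [f1 g1 z1 p1 [u1 zF1 sF1 _ q1P]]]] := grow_tree (t := t1) fs gs as_ ka.
  lia.
have bs : b \in used X (r1 ++ s) by rewrite usedE bX.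
have nX v : v \in X -> v \notin unzip2 r1.
  move=> vX; apply/negP => /(forest_catP f1); by rewrite usedE vX.
have kb1 : kids (r1 ++ s) b = 0.
  rewrite kids_cat kb kids_eq0 //; apply/negP => /p1; rewrite inE eq_sym (negbTE ab) /=.
  by rewrite (negbTE (nX _ bX)).
have [|r2 [F2 [f2 g2 z2 p2 [u2 zF2 sF2 _ q2P]]]] := grow_tree (t := t2) f1 g1 bs kb1.
  rewrite size_cat; lia.
(* Positive depth makes a leaf a new vertex rather than the root. *)
have lastP t (u : V) q (r : seq (V * V)) : 0 < t -> size q = t ->
    {subset steps (u :: q) <= r} -> last u q \in unzip2 r.
  move=> t0 zq sq; have : last u q \in q by case: q zq {sq} t0 => [<-|x q] //= _ _; exact: mem_last.
  by rewrite -{2}(unzip2_steps u q) => /mapP[p /sq pr ->]; exact: map_f.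
have F1r w : w \in F1 -> w \in unzip2 r1.
  by case/q1P => q [zq <- _ sq]; apply: lastP zq sq.
have F2r w : w \in F2 -> w \in unzip2 r2.
  by case/q2P => q [zq <- _ sq]; apply: lastP zq sq.
have new2 w : w \in unzip2 r2 -> w \notin used X (r1 ++ s) by exact: forest_catP.
have [|||w1] := joint (A := [set v in F1]) (A' := [set v in F2]).
- rewrite disjoint_subset; apply/subsetP => v; rewrite !inE => /F1r vr1.
  apply/negP => /F2r /new2; rewrite usedE /unzip2 map_cat mem_cat -/(unzip2 r1) vr1.
  by rewrite orbT.
- by rewrite cardsE (card_uniqP u1) zF1.
- by rewrite cardsE (card_uniqP u2) zF2.
rewrite inE => /q1P[q1 [zq1 lq1 uq1 sq1]] [w2]; rewrite inE => /q2P[q2 [zq2 lq2 uq2 sq2]] w12.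
have q1r v : v \in q1 -> v \in unzip2 r1.
  by rewrite -{1}(unzip2_steps a q1) => /mapP[p /sq1 pr ->]; exact: map_f.
have q2r v : v \in q2 -> v \in unzip2 r2.
  by rewrite -{1}(unzip2_steps b q2) => /mapP[p /sq2 pr ->]; exact: map_f.
(* Only the two joined branches survive. Pruning gives back all other tree vertices, so a finished
   link costs just [t1 + t2] of the budget [B]. *)
pose s' := steps (a :: q1) ++ steps (b :: q2) ++ s.
have ss' : {subset s' <= r2 ++ r1 ++ s}.
  move=> p; rewrite !mem_cat => /or3P[/sq1 ->|/sq2 ->|->]; by rewrite ?orbT.
have us' : uniq (unzip2 s').
  rewrite /unzip2 !map_cat -!/(unzip2 _) !unzip2_steps.
  rewrite !cat_uniq uq1 uq2 /=; apply/and3P; split.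
  - apply/hasPn => v; rewrite mem_cat => /orP[/q2r /new2 h|vs]; apply/negP => /q1r vr1.
      move: h; rewrite usedE /unzip2 map_cat mem_cat -/(unzip2 r1) vr1.
      by rewrite orbT.
    by have := forest_catP f1 vr1; rewrite usedE vs orbT.
  - apply/hasPn => v vs; apply: contraL vs => /q2r /new2; rewrite usedE /unzip2 map_cat mem_cat.
    by rewrite !negb_or => /and3P[].
  by case/andP: fs.
have perm' : perm_eq (unzip2 s') (q1 ++ rev q2 ++ unzip2 s).
  rewrite /unzip2 !map_cat -!/(unzip2 _) !unzip2_steps perm_cat2l perm_cat2r.
  by rewrite perm_sym perm_rev.
have f2' := f2; case/andP: f2' => u2' /allP a2.
exists (q1 ++ rev q2), s'; split; [split|split].
- by rewrite size_cat size_rev zq1 zq2.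
- rewrite -cats1 -catA -cat_cons.
  have -> : rev q2 ++ [:: b] = rev (b :: q2) by rewrite rev_cons cats1.
  have := sorted_forest f2 (q := a :: q1); have := sorted_forest f2 (q := b :: q2).
  move=> /(_ _) s2 /(_ _) s1.
  rewrite (lastI a q1) (lastI b q2) lq1 lq2 rev_rcons cat_rcons sorted_cat_cons.
  rewrite -{1}lq1 -lastI s1 /=; last by move=> p /sq1; rewrite !mem_cat => ->; rewrite orbT.
  rewrite w12 /= -/(sorted e (w2 :: _)) -rev_rcons -lq2 -lastI.
  rewrite sorted_rev_sym // s2 // => p /sq2; by rewrite mem_cat => ->.
- apply/andP; split=> //; apply/allP => p ps'; have /and3P[-> -> _] := a2 _ (ss' _ ps') => /=.
  rewrite usedE (perm_mem perm') !mem_cat mem_rev.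
  move: ps'; rewrite !mem_cat => /or3P[/(map_f fst)|/(map_f fst)|/(map_f fst)] /=.
  + rewrite -/(unzip1 _) unzip1_steps => /mem_belast; rewrite inE => /orP[/eqP ->|->].
      by rewrite aX.
    by rewrite orbT.
  + rewrite -/(unzip1 _) unzip1_steps => /mem_belast; rewrite inE => /orP[/eqP ->|->].
      by rewrite bX.
    by rewrite !orbT.
  + by move=> /(forest_parent fs); rewrite usedE => /orP[->|->]; rewrite ?orbT.
- by apply: prune f2 g2 _ ss'; apply: map_uniq us'.
- by rewrite -catA.
move=> v vX va vb; rewrite /s' !kids_cat (@kids_eq0 (steps (a :: q1))).
  rewrite (@kids_eq0 (steps (b :: q2))) // unzip1_steps.
  apply/negP => /mem_belast; rewrite inE (negbTE vb) /= => /q2r /new2.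
  by rewrite usedE vX.
rewrite unzip1_steps; apply/negP => /mem_belast; rewrite inE (negbTE va) /= => /q1r.
by apply/negP; exact: nX.
Qed.

(** The links are made one after another. Since each one is pruned before the next begins, the
    budget pays for the two trees only once. *)
Lemma links X s (ps : seq (V * V)) t1 t2 :
  0 < t1 -> 0 < t2 -> m <= 2 ^ t1 -> m <= 2 ^ t2 ->
  forest X s -> growable X s ->
  uniq (unzip1 ps ++ unzip2 ps) -> {subset unzip1 ps ++ unzip2 ps <= X} ->
  (forall v, v \in unzip1 ps ++ unzip2 ps -> kids s v = 0) ->
  #|X| + size s + size ps * (t1 + t2) + 2 ^ t1.+1 + 2 ^ t2.+1 <= B ->
  exists qs, [/\ size qs = size ps, all (fun q => size q == t1 + t2) qs,
    uniq (flatten qs),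
    all (fun z => (z \notin used X s) && [exists u, z \in N u]) (flatten qs) &
    all (fun pq => sorted e (pq.1.1 :: rcons pq.2 pq.1.2)) (zip ps qs)].
Proof.
move=> t1_gt0 t2_gt0 mt1 mt2; elim: ps s => [|[a b] ps IH] s fs gs.
  by move=> _ _ _ _; exists [::].
have perm : perm_eq (unzip1 ((a, b) :: ps) ++ unzip2 ((a, b) :: ps))
                    ([:: a; b] ++ (unzip1 ps ++ unzip2 ps)).
  by rewrite /= perm_cons -cat_rcons -cats1 -catA perm_catCA.
rewrite (perm_uniq perm) => /= /and3P[a_new b_new uq] sX k sB.
have {}sX v : v \in [:: a; b] ++ (unzip1 ps ++ unzip2 ps) -> v \in X.
  by rewrite -(perm_mem perm); apply: sX.
have {}k v : v \in [:: a; b] ++ (unzip1 ps ++ unzip2 ps) -> kids s v = 0.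
  by rewrite -(perm_mem perm); apply: k.
have aX : a \in X by apply: sX; rewrite !inE eqxx.
have bX : b \in X by apply: sX; rewrite !inE eqxx orbT.
have ab : a != b by move: a_new; rewrite inE negb_or => /andP[].
have [|||q [s' [[zq pq fs' gs'] [ps' ks']]]] := link aX bX ab fs gs _ _ t1_gt0 t2_gt0 mt1 mt2.
- by apply: k; rewrite !inE eqxx.
- by apply: k; rewrite !inE eqxx orbT.
- by move: sB; rewrite mulSn; lia.
have zs' : size s' = size q + size s.
  by have := perm_size ps'; rewrite size_cat !size_map.
have [|||qs [zqs aqs uqs nqs sqs]] := IH s' fs' gs' uq.
- by move=> v vps; apply: sX; rewrite mem_cat vps orbT.
- move=> v vps; rewrite ks'; first by apply: k; rewrite mem_cat vps orbT.
  + by apply: sX; rewrite mem_cat vps orbT.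
  + by apply: contraNneq a_new => <-; rewrite inE vps orbT.
  + by apply: contraNneq b_new => <-.
- by rewrite zs' zq; move: sB; rewrite mulSn; lia.
have us' : uniq (q ++ unzip2 s).
  by rewrite -(perm_uniq ps'); case/andP: fs'.
have uE v : v \in used X s' = [|| v \in X, v \in q | v \in unzip2 s].
  by rewrite usedE (perm_mem ps') mem_cat.
exists (q :: qs); split=> /=.
- by rewrite zqs.
- by rewrite zq eqxx.
- rewrite cat_uniq uqs andbT; move: us'; rewrite cat_uniq => /andP[-> _] /=.
  apply/hasPn => z /(allP nqs) /andP[+ _]; by rewrite uE !negb_or => /and3P[].
- rewrite all_cat; apply/andP; split; last first.
    apply: sub_all nqs => z /andP[+ ->]; rewrite uE usedE !negb_or => /and3P[-> _ ->] //.
  apply/allP => z zq'; have /(forest_kid fs') /andP[zX ->] : z \in unzip2 s'.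
    by rewrite (perm_mem ps') mem_cat zq'.
  rewrite andbT usedE negb_or zX /=.
  by move: us'; rewrite cat_uniq => /and3P[_ /hasPn h _]; apply/negP => /h /=; rewrite zq'.
by move: pq => /= ->.
Qed.

End Linking.

(** * Parity switchers and potentials *)

Import GRing.Theory.

Definition close (T : Type) (c : seq T) := if c is x :: _ then rcons c x else [::].

Lemma cycle_close (T : Type) (e : rel T) c : cycle e c = sorted e (close c).
Proof. by case: c. Qed.

Section PathSum.
Local Open Scope ring_scope.
Variables (V : eqType) (M : zmodType) (g : V -> V -> M).
Hypothesis g_sym : forall x y, g x y = g y x.
Hypothesis M2 : forall x : M, x + x = 0.

Definition psum s := \sum_(p <- steps s) g p.1 p.2.

Lemma psum_cat s x t : psum (s ++ x :: t) = psum (rcons s x) + psum (x :: t).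
Proof. by rewrite /psum steps_cat big_cat. Qed.

Lemma psum_cons2 x y s : psum (x :: y :: s) = g x y + psum (y :: s).
Proof. by rewrite /psum big_cons. Qed.

Lemma psum2 x y : psum [:: x; y] = g x y.
Proof. by rewrite psum_cons2 /psum big_nil addr0. Qed.

Lemma psum_rev s : psum (rev s) = psum s.
Proof.
rewrite /psum steps_rev (perm_big [seq (p.2, p.1) | p <- steps s]) ?perm_rev //=.
by rewrite big_map; apply: eq_bigr => p _; exact: g_sym.
Qed.

Lemma add_eq0 x y : x + y = 0 :> M -> x = y.
Proof. by move=> xy; rewrite -[x]addr0 -(M2 y) addrA xy add0r. Qed.

Lemma addKx (x y : M) : x + (x + y) = y.
Proof. by rewrite addrA M2 add0r. Qed.

End PathSum.

(** * Ladders and their two zigzag traversals *)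

Section Zigzag.
Variables (V : eqType) (e : rel V).
Hypothesis e_sym : symmetric e.
Implicit Types (rs : seq (V * V * seq V)) (rho : V * V * seq V) (b : bool).

(** A rung is a triple: left end, right end, interior vertices of the path between them. The Boolean
    tells from which end it is entered. *)
Definition rung_end b rho := if b then rho.1.2 else rho.1.1.
Definition rung rho := rho.1.1 :: rcons rho.2 rho.1.2.
Definition run b rho := if b then rev (rung rho) else rung rho.

(** The rungs are crossed in alternating directions, so every second edge of each rail is used. The
    two starting values of [b] use complementary sets of rail edges. *)
Fixpoint zigzag b rs :=
  if rs is rho :: rs' then run b rho ++ zigzag (~~ b) rs' else [::].

Lemma runE b rho : run b rho =
  rung_end b rho :: rcons (if b then rev rho.2 else rho.2) (rung_end (~~ b) rho).
Proof. by case: b => //=; rewrite rev_cons rev_rcons. Qed.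

Lemma perm_zigzag b (ps : seq (V * V)) qs : size qs = size ps ->
  perm_eq (zigzag b (zip ps qs)) (unzip1 ps ++ unzip2 ps ++ flatten qs).
Proof.
elim: ps qs b => [|[l r] ps IH] [|q qs] b //= [sz].
have rp : perm_eq (run b (l, r, q)) (l :: r :: q).
  apply/permP => P; rewrite runE /rung_end.
  by case: b; rewrite /= -cats1 count_cat /= ?count_rev; lia.
apply/permP => P.
rewrite !count_cat (permP rp) (permP (IH _ (~~ b) sz)) /= count_cat -[r :: _]cat1s !count_cat /=; lia.
Qed.

(** Here [x] and [y] precede the two rails. Crossing a rung exchanges the rails, which is why the
    induction carries both. *)
Lemma sorted_zigzag b rs x y z : all (fun rho => sorted e (rung rho)) rs ->
  sorted e (x :: rcons (map (rung_end b) rs) z) ->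
  sorted e (y :: rcons (map (rung_end (~~ b)) rs) z) ->
  sorted e (x :: rcons (zigzag b rs) z).
Proof.
elim: rs b x y => [|rho rs IH] b x y //= /andP[srho srs] /andP[ex sx] /andP[ey sy].
have srun : sorted e (run b rho) by rewrite /run; case: (b); rewrite ?sorted_rev_sym.
have {IH} := IH (~~ b) _ _ srs sy; rewrite negbK => /(_ _ sx) IH.
move: srun; rewrite runE => srun.
rewrite rcons_cat /= ex /= cat_rcons.
set t := _ ++ _; rewrite -/(sorted e (_ :: t)) /t -cat_cons sorted_cat_cons.
by rewrite [X in X && _]srun.
Qed.

Local Open Scope ring_scope.
Variables (M : zmodType) (g : V -> V -> M).
Hypothesis g_sym : forall x y, g x y = g y x.
Hypothesis M2 : forall x : M, x + x = 0.

(** Both traversals run through every rung, so the rungs cancel in characteristic two and only the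
    rails remain. *)
Lemma psum_zigzag b rs x y z :
  psum g (x :: rcons (zigzag b rs) z) + psum g (y :: rcons (zigzag (~~ b) rs) z) =
  psum g (x :: rcons (map (rung_end b) rs) z) +
  psum g (y :: rcons (map (rung_end (~~ b)) rs) z).
Proof.
elim: rs b x y => [|rho rs IH] b x y //=.
have E c w : psum g (w :: rcons (run c rho ++ zigzag (~~ c) rs) z) =
    g w (rung_end c rho) + psum g (rung rho) +
    psum g (rung_end (~~ c) rho :: rcons (zigzag (~~ c) rs) z).
  rewrite runE rcons_cat cat_cons psum_cons2 cat_rcons -cat_cons psum_cat rcons_cons -runE.
  by rewrite /run; case: (c); rewrite ?psum_rev // addrA.
rewrite !E !psum_cons2 addrACA [X in X + _ = _]addrACA M2 addr0 [RHS]addrACA.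
have := IH (~~ b) (rung_end (~~ b) rho) (rung_end b rho).
by rewrite !negbK => ->; congr (_ + _); rewrite addrC.
Qed.

End Zigzag.

Section Switch.
Variables (V : finType) (e : rel V) (M : zmodType) (g : V -> V -> M).
Hypothesis e_sym : symmetric e.
Hypothesis g_sym : forall x y, g x y = g y x.
Hypothesis M2 : forall x : M, (x + x = 0)%R.

Lemma switch x y L R qs s : size R = size L -> size qs = size L ->
  cycle e (x :: L ++ y :: rev R) ->
  all (fun rho => sorted e (rung rho)) (zip (zip L R) qs) ->
  sorted e (y :: rcons s x) ->
  perm_eq (x :: L ++ y :: R ++ flatten qs ++ s) (enum V) ->
  exists h1 h2,
    [/\ uniq h1, size h1 = #|V| & cycle e h1] /\
    [/\ uniq h2, size h2 = #|V|, cycle e h2 &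
        psum g (close (x :: L ++ y :: rev R)) = (psum g (close h1) + psum g (close h2))%R].
Proof.
move=> szR szq cyc srs srest perm.
pose rs := zip (zip L R) qs.
have mapL : map (rung_end false) rs = L.
  rewrite /rs (_ : rung_end false = fst \o fst) // map_comp -/(unzip1 (zip _ qs)) unzip1_zip.
    by rewrite -/(unzip1 (zip _ _)) unzip1_zip // szR.
  by rewrite size_zip szR minnn szq.
have mapR : map (rung_end true) rs = R.
  rewrite /rs (_ : rung_end true = snd \o fst) // map_comp -/(unzip1 (zip _ qs)) unzip1_zip.
    by rewrite -/(unzip2 (zip _ _)) unzip2_zip // szR.
  by rewrite size_zip szR minnn szq.
rewrite cycle_close /close rcons_cons rcons_cat rcons_cons -cat_cons in cyc.
rewrite sorted_cat_cons in cyc; case/andP: cyc => sL sR.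
have {}sR : sorted e (x :: rcons R y).
  by rewrite -sorted_rev_sym // rev_cons rev_rcons.
(* The two Hamilton cycles share all rungs and the closing path [y :: rcons s x]; these cancel, and
   the rails form the given cycle. *)
pose h b := x :: zigzag b rs ++ y :: s.
have hperm b : perm_eq (h b) (enum V).
  apply: perm_trans perm; apply/permP => P /=; rewrite !count_cat /=.
  rewrite (permP (perm_zigzag b _)) ?size_zip ?szR ?minnn //.
  rewrite unzip1_zip ?unzip2_zip ?szR // !count_cat -!addnA; congr (_ + (_ + _)).
  by rewrite [RHS]addnCA; congr (_ + _); rewrite addnCA.
have hu b : uniq (h b) by rewrite (perm_uniq (hperm b)) enum_uniq.
have hs b : size (h b) = #|V| by rewrite (perm_size (hperm b)) -cardE.
have hc b : cycle e (h b).
  rewrite cycle_close /h /close rcons_cons rcons_cat rcons_cons -cat_cons.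
  rewrite sorted_cat_cons srest andbT -/(rcons (x :: _) _) rcons_cons.
  by apply: (@sorted_zigzag _ _ e_sym b rs x x y srs); case: b; rewrite ?mapL ?mapR.
have hp b : psum g (close (h b)) = (psum g (x :: rcons (zigzag b rs) y) + psum g (y :: rcons s x))%R.
  by rewrite /close /h rcons_cons rcons_cat rcons_cons -cat_cons psum_cat rcons_cons.
exists (h false), (h true); split; first by split.
split=> //; rewrite !hp addrACA M2 addr0 (psum_zigzag g_sym M2 false) mapL mapR.
rewrite /close rcons_cons rcons_cat rcons_cons -cat_cons psum_cat; congr (_ + _)%R.
by rewrite -[RHS]psum_rev // rev_cons rev_rcons.
Qed.

End Switch.

(** * A potential from the vanishing of short even cycles *)

Section Potential.
Local Open Scope ring_scope.
Variables (V : finType) (e : rel V) (M : zmodType) (g : V -> V -> M) (l : nat).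
Hypothesis e_sym : symmetric e.
Hypothesis e_irr : irreflexive e.
Hypothesis g_sym : forall x y, g x y = g y x.
Hypothesis M2 : forall x : M, x + x = 0.
Hypothesis l_gt0 : (0 < l)%N.
Hypothesis short_even : forall c, uniq c -> (2 < size c <= 6 * l + 8)%N ->
  ~~ odd (size c) -> cycle e c -> psum g (close c) = 0.
Hypothesis short_path : forall (X : {set V}) x y (b : bool), x != y -> (#|X| <= 8 * l + 10)%N ->
  exists q, [/\ size q = (l.*2 + b)%N, uniq q,
    all (fun z => (z \notin X) && (z \notin [:: x; y])) q & sorted e (x :: rcons q y)].

Let pth x q y := uniq (x :: rcons q y) && sorted e (x :: rcons q y).

Let short_pth (X : {set V}) x y (b : bool) : x != y -> (#|X| <= 8 * l + 10)%N ->
  exists q, [/\ size q = (l.*2 + b)%N, all (fun z => z \notin X) q & pth x q y].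
Proof.
move=> xy Xl; have [q [zq uq aq sq]] := short_path b xy Xl.
exists q; split=> //; first by apply: sub_all aq => z /andP[].
rewrite /pth sq andbT /= rcons_uniq uq andbT mem_rcons inE (negbTE xy) /=.
by apply/andP; split; apply/negP => /(allP aq); rewrite !inE eqxx ?orbT andbF.
Qed.

(** The two paths may meet, so both are compared with a third path of the same parity that avoids
    them. Each comparison is an even cycle short enough for [short_even]. *)
Let val_eq x y q1 q2 : pth x q1 y -> pth x q2 y -> odd (size q1) = odd (size q2) ->
  (size q1 <= 4 * l + 4)%N -> (size q2 <= 4 * l + 4)%N ->
  psum g (x :: rcons q1 y) = psum g (x :: rcons q2 y).
Proof.
move=> p1 p2 oq z1 z2.
have xy : x != y by case/andP: p1 => /=; rewrite mem_rcons inE negb_or -andbA => /andP[].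
have [|r [zr ar pr]] := @short_pth [set v in q1 ++ q2] x y (odd (size q1)) xy.
  by rewrite cardsE (leq_trans (card_size _)) // size_cat; apply: leq_trans (leq_add z1 z2) _; lia.
have H q : pth x q y -> odd (size q) = odd (size q1) -> (size q <= 4 * l + 4)%N ->
    {subset q <= q1 ++ q2} -> psum g (x :: rcons q y) = psum g (x :: rcons r y).
  move=> /andP[uq sq] oq' zq sub; apply: add_eq0 => //.
  case/andP: pr => ur sr.
  have -> : psum g (x :: rcons q y) + psum g (x :: rcons r y) =
            psum g (close (x :: q ++ y :: rev r)).
    rewrite /close rcons_cons rcons_cat rcons_cons -cat_cons psum_cat rcons_cons.
    by rewrite -[in RHS](psum_rev g_sym (y :: _)) rev_cons rev_rcons revK.
  apply: short_even.
  - rewrite -cat_rcons -cat_cons cat_uniq uq rev_uniq /=; move: ur.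
    rewrite /= mem_rcons inE negb_or rcons_uniq => /andP[/andP[_ xr] /andP[yr ->]].
    rewrite andbT; apply/hasPn => v; rewrite mem_rev => vr.
    rewrite inE mem_rcons inE !negb_or; apply/and3P; split.
    + by apply: contraNneq xr => <-.
    + by apply: contraNneq yr => <-.
    + by apply: contraL (allP ar _ vr) => /sub; rewrite inE => ->.
  - rewrite /= size_cat /= size_rev zr; have := leq_b1 (odd (size q1)).
    by set z := size q in zq *; set o := nat_of_bool _; lia.
  - rewrite /= size_cat /= size_rev zr !addnS /= negbK oddD oq' oddD odd_double /=.
    by case: (odd _).
  - rewrite cycle_close /close rcons_cons rcons_cat rcons_cons -cat_cons.
    rewrite sorted_cat_cons sq -sorted_rev_sym // rev_cons rev_rcons revK; exact: sr.
rewrite (H q1) // ?(H q2) // => v; by rewrite mem_cat => ->; rewrite ?orbT.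
Qed.

(** The potential of [v] is the sum of [g] along a path from [r] with an even number of edges, and
    zero at [r]. The constant [tau] is the difference between odd and even path sums, which is the
    same at every vertex. *)
Lemma potential (r v0 : V) : r != v0 ->
  exists (a : V -> M) tau, forall u v, e u v -> g u v = a u + a v + tau.
Proof.
move=> rv0.
have [|f fP] := @fin_all_exists (V * bool)%type (fun=> seq V)
    (fun p q => r != p.1 -> size q = (l.*2 + p.2)%N /\ pth r q p.1).
  case=> v b /=; have [->|rv] := eqVneq r v; first by exists [::].
  by have [|q [zq _ pq]] := @short_pth finset.set0 r v b rv; [rewrite cards0 | exists q].
pose P b v := psum g (r :: rcons (f (v, b)) v).
have PE b v q : pth r q v -> (size q <= 4 * l + 4)%N -> odd (size q) = b ->
    psum g (r :: rcons q v) = P b v.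
  move=> pq zq oq.
  have rv : r != v by case/andP: pq => /=; rewrite mem_rcons inE negb_or -andbA => /andP[].
  have [zf pf] := fP (v, b) rv.
  apply: val_eq => //; rewrite zf /= ?oddD ?odd_double ?oq /=; first by case: (b).
  by have := leq_b1 b; lia.
(* A path from [r] to [u] avoiding [rcons q v] is prolonged by [q]. The added piece has an odd
   number of edges, which flips the parity. *)
have PS b u v q : r != u -> r != v -> pth u q v -> r \notin q -> (size q <= l.*2)%N ->
    ~~ odd (size q) -> P b v = P (~~ b) u + psum g (u :: rcons q v).
  move=> ru rv pq rq zq oq.
  have [|Q [zQ aQ pQ]] := @short_pth [set w in rcons q v] r u (~~ b) ru.
    by rewrite cardsE (leq_trans (card_size _)) // size_rcons; set z := size q in zq *; lia.
  rewrite -(PE (~~ b) u Q) //; first last.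
  - by rewrite zQ oddD odd_double; case: (b).
  - by rewrite zQ; have := leq_b1 (~~ b); lia.
  rewrite -(PE b v (Q ++ u :: q)).
  - by rewrite rcons_cat rcons_cons -cat_cons psum_cat rcons_cons.
  - case/andP: pq => uq sq; case/andP: pQ => uQ sQ.
    apply/andP; rewrite rcons_cat rcons_cons -cat_cons sorted_cat_cons sQ sq; split=> //.
    rewrite -cat_rcons rcons_cons cat_uniq uQ /=.
    move: uq; rewrite cons_uniq => /andP[uqv ->]; rewrite andbT.
    apply/hasPn => w wq; rewrite inE mem_rcons inE !negb_or; apply/and3P; split.
    + apply: contraTneq wq => ->; by rewrite mem_rcons inE negb_or rv rq.
    + by apply: contraNneq uqv => <-.
    + by apply: contraL wq => /(allP aQ); rewrite inE.
  - by rewrite size_cat /= zQ; set z := size q in zq *; have := leq_b1 (~~ b); lia.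
  - rewrite size_cat zQ /= addnS /= !oddD odd_double /= (negbTE oq) addbF.
    by case: (b).
pose tau := P true v0 + P false v0.
(* Both parities change by the same sum along a path from [v] to [v0], so their difference does not
   change. *)
have tauE v : r != v -> P false v = P true v + tau.
  move=> rv; suff -> : tau = P true v + P false v by rewrite addKx.
  rewrite /tau; have [->|vv0] := eqVneq v v0; first by [].
  have [|q [zq aq pq]] := @short_pth [set r] v v0 false vv0; first by rewrite cards1; lia.
  have rq : r \notin q by apply/negP => /(allP aq); rewrite inE eqxx.
  have h b := PS b v v0 q rv rv0 pq rq.
  rewrite !h ?zq ?addn0 ?odd_double // addrACA M2 addr0 addrC //.
exists (fun v => if v == r then 0 else P true v), tau => u v.
have [-> {u}|ur] := eqVneq u r; have [->|vr] := eqVneq v r.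
- by rewrite e_irr.
- move=> ev; rewrite add0r -tauE 1?eq_sym // -(PE false v [::]) ?psum2 //.
  by rewrite /pth /= ev inE eq_sym vr.
- move=> ev; rewrite addr0 -tauE 1?eq_sym // -(PE false u [::]) ?psum2 //.
  by rewrite /pth /= e_sym ev inE eq_sym ur.
move=> ev; rewrite addrAC -(tauE u) 1?eq_sym // (PS true u v [::]) ?psum2 //=.
- by rewrite addKx.
- by rewrite eq_sym.
- by rewrite eq_sym.
- by rewrite /pth /= ev inE !andbT; apply: contraTneq ev => ->; rewrite e_irr.
Qed.

End Potential.

(** * Posa rotations *)

Section StepsUniq.
Variable T : eqType.
Implicit Types (s t : seq T) (a b c : T).

Lemma steps_mid s1 a b s2 : (a, b) \in steps (s1 ++ a :: b :: s2).
Proof. by rewrite steps_cat mem_cat inE eqxx orbT. Qed.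

Lemma steps_split s a b : (a, b) \in steps s -> exists s1 s2, s = s1 ++ a :: b :: s2.
Proof.
elim: s => [|c [|d s] IH] //; rewrite inE => /orP[/eqP[-> ->]|/IH[s1 [s2 ->]]].
  by exists [::], s.
by exists (c :: s1), s2.
Qed.

Lemma uniq_cat_inj s1 s2 t1 t2 a : uniq (s1 ++ a :: s2) ->
  s1 ++ a :: s2 = t1 ++ a :: t2 -> s1 = t1 /\ s2 = t2.
Proof.
move=> us E; have ut : uniq (t1 ++ a :: t2) by rewrite -E.
have idx r1 r2 : uniq (r1 ++ a :: r2) -> index a (r1 ++ a :: r2) = size r1.
  rewrite cat_uniq => /and3P[_ /hasPn h _]; rewrite index_cat /= eqxx addn0.
  by have := h a; rewrite inE eqxx => /(_ isT) /negbTE ->.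
have sz : size s1 = size t1 by rewrite -(idx s1 s2) // E idx.
by move/eqP: E; rewrite eqseq_cat // => /andP[/eqP -> /eqP[->]].
Qed.

Lemma steps_fun s a b c : uniq s -> (a, b) \in steps s -> (a, c) \in steps s -> b = c.
Proof.
move=> us /steps_split[s1 [s2 E]] /steps_split[t1 [t2 E']].
rewrite E in us; have E2 : s1 ++ a :: b :: s2 = t1 ++ a :: c :: t2 by rewrite -E.
by have [_ [->]] := uniq_cat_inj us E2.
Qed.

Lemma steps_inj s a b c : uniq s -> (b, a) \in steps s -> (c, a) \in steps s -> b = c.
Proof.
move=> us /steps_split[s1 [s2 E]] /steps_split[t1 [t2 E']].
rewrite E -cat_rcons in us.
have E2 : rcons s1 b ++ a :: s2 = rcons t1 c ++ a :: t2 by rewrite !cat_rcons -E.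
by have [/rcons_inj[]] := uniq_cat_inj us E2.
Qed.

Lemma steps_behead s a b : (a, b) \in steps s -> b \in behead s.
Proof.
case/steps_split=> [] [|c s1] [s2 ->] /=; rewrite ?mem_cat !inE eqxx ?orbT //.
Qed.

Definition adjin s a b := ((a, b) \in steps s) || ((b, a) \in steps s).

Lemma adjin_rev s a b : adjin (rev s) a b = adjin s a b.
Proof.
rewrite /adjin steps_rev !mem_rev; have H c d :
    ((c, d) \in [seq (p.2, p.1) | p <- steps s]) = ((d, c) \in steps s).
  apply/mapP/idP => [[[c' d'] h [-> ->]] //|h]; by exists (d, c).
by rewrite !H orbC.
Qed.

Lemma adjin_cat s x t a b : adjin (s ++ x :: t) a b = adjin (rcons s x) a b || adjin (x :: t) a b.
Proof. by rewrite /adjin steps_cat !mem_cat orbACA. Qed.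

Lemma adjin_mem s a b : adjin s a b -> (a \in s) && (b \in s).
Proof. by rewrite /adjin => /orP[|] /mem_steps // /andP[-> ->]. Qed.

End StepsUniq.

Section Posa.
Variables (V : finType) (W : {set V}) (x y : V).
Implicit Types (e : rel V) (s : seq V).

Definition forced a b := ((a == x) && (b == y)) || ((a == y) && (b == x)).

Lemma forcedC a b : forced a b = forced b a.
Proof. by rewrite /forced orbC andbC [X in _ || X]andbC. Qed.

(* The pair [x, y] plays the role of an edge that every path must keep, so that
   a Hamilton cycle through it is a Hamilton path from [x] to [y]. *)
Definition rel_forced e a b := e a b || forced a b.

Lemma rel_forced_sym e : symmetric e -> symmetric (rel_forced e).
Proof. by move=> e_sym a b; rewrite /rel_forced e_sym forcedC. Qed.

Definition fpath e s := [&& uniq s, all (mem W) s, sorted (rel_forced e) s & adjin s x y].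

Definition hampath e :=
  exists s, [/\ uniq (x :: s), sorted e (x :: s), last x s = y & x :: s =i W].

Section Rotation.
Variables (e : rel V).
Hypothesis e_sym : symmetric e.

(** A Posa rotation: the tail after [z] is reversed with the help of an edge from the last vertex to
    [z]. The first vertex stays, [w] becomes the last one, and the forced pair is never broken. *)
Inductive reach s : seq V -> Prop :=
| reach0 : reach s s
| reachS s1 z w s2 : reach s (s1 ++ z :: w :: s2) -> e (last w s2) z -> ~~ forced z w ->
    reach s (s1 ++ z :: rev (w :: s2)).

Lemma adjin_rotate s1 z w s2 a b : adjin (s1 ++ z :: w :: s2) a b ->
  adjin (s1 ++ z :: rev (w :: s2)) a b || ([set a; b] == [set z; w]).
Proof.
rewrite !adjin_cat => /orP[->//|].
rewrite {1}/adjin -[steps _]/((z, w) :: steps (w :: s2)) !inE.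
have R : adjin (w :: s2) a b -> adjin (z :: rev (w :: s2)) a b.
  rewrite -(adjin_rev (w :: s2)); case: (rev _) => [|c r] //.
  by rewrite {2}/adjin -[steps (z :: _)]/((z, c) :: steps (c :: r)) !inE => /orP[]->; rewrite ?orbT.
rewrite orbACA => /orP[/orP[]/eqP[-> ->]|]; rewrite ?eqxx ?orbT //.
  by rewrite setUC eqxx orbT.
by move/R => ->; rewrite orbT.
Qed.

Lemma reach_fpath s s' : fpath e s -> reach s s' ->
  [/\ fpath e s', perm_eq s' s & forall c, head c s' = head c s].
Proof.
move=> fs; elim=> {s'} [|s1 z w s2 _ [fs' ps hs] ez nf]; first by split.
have pr : perm_eq (s1 ++ z :: rev (w :: s2)) (s1 ++ z :: w :: s2).
  by rewrite perm_cat2l perm_cons perm_rev.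
split; [|exact: perm_trans pr ps|by move=> c; rewrite -hs; case: (s1)].
case/and4P: fs' => us aW ss adj; apply/and4P; split.
- by rewrite (perm_uniq pr).
- by rewrite (perm_all _ pr).
- move: ss; rewrite !sorted_cat_cons => /andP[-> /=] /andP[_ ss].
  have := sorted_rev_sym (w :: s2) (rel_forced_sym e_sym).
  rewrite /= ss lastI rev_rcons /= => ->.
  by rewrite /rel_forced e_sym ez.
- have /orP[//|/eqP E] := adjin_rotate adj; move: nf; case/negP.
  have zw : z != w.
    by apply/eqP => zw; move: us; rewrite zw cat_uniq /= inE eqxx /= !andbF.
  have : z \in [set x; y] by rewrite E !inE eqxx.
  have : w \in [set x; y] by rewrite E !inE eqxx orbT.
  rewrite !inE => /orP[]/eqP hw /orP[]/eqP hz; move: zw; rewrite /forced hw hz !eqxx ?orbT //.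
Qed.

Definition ends s : {set V} := [set v | `[< exists2 s', reach s s' & last x s' = v >]].

Lemma mem_ends s s' : reach s s' -> last x s' \in ends s.
Proof. by move=> r; rewrite inE; apply/asboolP; exists s'. Qed.

(** A rotation destroys only the pair of [z] and [w], and [w] becomes an end. *)
Lemma reach_adjin s s' a b : reach s s' -> adjin s a b ->
  [|| adjin s' a b, a \in ends s | b \in ends s].
Proof.
move=> r ab; elim: r => {s'} [|s1 z w s2 r IH ez nf]; first by rewrite ab.
have wS : w \in ends s.
  by have := mem_ends (reachS r ez nf); rewrite last_cat /= rev_cons last_rcons.
case/or3P: IH => [/adjin_rotate/orP[->//|/eqP E]|->|->]; rewrite ?orbT //.
have : w \in [set a; b] by rewrite E !inE eqxx orbT.
by rewrite in_set2 => /orP[]/eqP <-; rewrite wS ?orbT.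
Qed.

Definition enbrs (S : {set V}) : {set V} := [set z in W | (z \notin S) && [exists v in S, e v z]].

(** Posa's lemma. An outside neighbour [z] of an end lies on the path by maximality, and a rotation
    at [z] makes its successor [w] an end unless [z] and [w] are the forced pair. Neighbours of [z]
    on [s] that are not ends are still next to [z] after the rotations. Hence [z] is next to an end
    on [s], or is one of [x], [y]; the latter account for the summand two. *)
Lemma posa s : fpath e s -> (forall s', fpath e s' -> size s' <= size s) ->
  #|enbrs (ends s)| <= (#|ends s|).*2.+2.
Proof.
move=> fs smax; set S := ends s.
(* Default values occur at the end of [s] and off [s]. They are harmless, since only the sizes of
   the images are used. *)
pose succ v := nth x s (index v s).+1; pose pred v := nth x s (index v s).-1.
have idx r1 a r2 : uniq (r1 ++ a :: r2) -> index a (r1 ++ a :: r2) = size r1.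
  rewrite cat_uniq => /and3P[_ /hasPn h _]; rewrite index_cat /= eqxx addn0.
  by have := h a; rewrite inE eqxx => /(_ isT) /negbTE ->.
have us : uniq s by case/and4P: fs.
have succP a b : (a, b) \in steps s -> succ a = b.
  case/steps_split=> s1 [s2 E]; rewrite /succ; move: us; rewrite E => us'.
  by rewrite idx // nth_cat ltnNge leqnSn /= subSnn.
have predP a b : (a, b) \in steps s -> pred b = a.
  case/steps_split=> s1 [s2 E]; rewrite /pred; move: us; rewrite E -cat_rcons => us'.
  by rewrite idx // size_rcons /= nth_cat size_rcons ltnSn nth_rcons ltnn eqxx.
suff sub : enbrs S \subset (succ @: S :|: pred @: S) :|: [set x; y].
  apply: leq_trans (subset_leq_card sub) _.
  apply: leq_trans (leq_card_setU _ _) _.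
  rewrite -addn2 -addnn leq_add //; last by rewrite cards2; case: eqP.
  by apply: leq_trans (leq_card_setU _ _) (leq_add _ _); exact: leq_imset_card.
have toS b z : b \in S -> adjin s z b -> z \in (succ @: S :|: pred @: S) :|: [set x; y].
  move=> bS /orP[/predP <-|/succP <-]; rewrite !inE.
    by rewrite (imset_f pred bS) !orbT.
  by rewrite (imset_f succ bS).
apply/subsetP => z; rewrite inE => /and3P[zW zS /exists_inP[v]].
rewrite [v \in _]inE => /asboolP[s' rs' <- {v}] ez.
have [fs' ps hs] := reach_fpath fs rs'; have /and4P[us' aW' ss' ad'] := fs'.
have zs' : z \in s'.
  apply: contraT => zs'; have := smax (rcons s' z).
  rewrite size_rcons (perm_size ps) ltnn; apply; apply/and4P; split.
  - by rewrite rcons_uniq zs'.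
  - by rewrite all_rcons /= zW.
  - case: (lastP s') ss' ez => [|t v] //; rewrite last_rcons => ss' ez.
    rewrite -(cats1 (rcons t v)) cat_rcons sorted_cat_cons ss' /=.
    by rewrite /rel_forced ez.
  - move: ad'; rewrite /adjin; case: (lastP s') => [|t v] //.
    by rewrite steps_rcons2 !mem_rcons !inE => /orP[]->; rewrite !orbT.
have zlast : z != last x s by apply: contraNneq zS => ->; exact: mem_ends (reach0 s).
have zlast' : z != last x s' by apply: contraNneq zS => ->; exact: mem_ends rs'.
case/splitPr: zs' => s1 s2 in rs' fs' ps hs us' aW' ss' ad' ez zlast' *.
case: s2 => [|w s2] in rs' fs' ps hs us' aW' ss' ad' ez zlast' *.
  by move: zlast'; rewrite last_cat /= eqxx.
rewrite last_cat /= in ez.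
have [zw|nzw] := boolP (forced z w).
  by rewrite !inE; case/orP: zw => /andP[/eqP -> _]; rewrite eqxx ?orbT.
have wS : w \in S.
  by have := mem_ends (reachS rs' ez nzw); rewrite last_cat /= rev_cons last_rcons.
have zw' : (z, w) \in steps (s1 ++ z :: w :: s2) by exact: steps_mid.
have zs : z \in s by rewrite -(perm_mem ps) mem_cat inE eqxx orbT.
have [t1 [t2 Es]] : exists t1 t2, s = t1 ++ z :: t2.
  by case/splitPr: zs => t1 t2; exists t1, t2.
case: t2 Es => [|b t2] Es; first by move: zlast; rewrite Es last_cat /= eqxx.
have zb : (z, b) \in steps s by rewrite Es; exact: steps_mid.
have zb' : adjin s z b by rewrite /adjin zb.
have /or3P[/orP[h|h]|h|h] := reach_adjin rs' zb'.
- by apply: (toS b) => //; rewrite (steps_fun us' h zw').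
(* In [s'] the vertex [b] precedes [z]. Rotations fix the first vertex, so [z] does not start [s]
   and has a predecessor [a] there. As [a] and [b] differ, either [a] is the successor [w] in [s']
   or [a] is an end. *)
- case: (lastP t1) Es => [|t a] Es.
    have := hs x; rewrite Es /= => hz; have := steps_behead h; move: us'.
    case: (s1) hz => [|c s3] /= hz; first by case/andP=> /negP.
    by rewrite hz mem_cat inE eqxx orbT.
  rewrite cat_rcons in Es.
  have az : (a, z) \in steps s by rewrite Es; exact: steps_mid.
  have az' : adjin s z a by rewrite /adjin az orbT.
  have /or3P[/orP[h'|h']|h'|h'] := reach_adjin rs' az'.
  + by apply: (toS a) => //; rewrite (steps_fun us' h' zw').
  + have ab := steps_inj us' h' h; move: us; rewrite Es ab cat_uniq /= !inE eqxx.
    by rewrite !orbT /= !andbF.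
  + by rewrite (negbTE zS) in h'.
  + exact: (toS a).
- by rewrite (negbTE zS) in h.
- exact: (toS b).
Qed.

Lemma fpath_rev s : fpath e (rev s) = fpath e s.
Proof.
by rewrite /fpath rev_uniq all_rev sorted_rev_sym ?adjin_rev //; exact: rel_forced_sym.
Qed.

Lemma sorted_unforced s : sorted (rel_forced e) s -> ~~ ((x \in s) && (y \in s)) -> sorted e s.
Proof.
rewrite !sorted_steps => /allP h nxy; apply/allP => -[a b] ab; have := h _ ab.
case/orP=> //= /orP[]/andP[/eqP E1 /eqP E2]; move: (mem_steps ab); rewrite E1 E2.
  by move/(negP nxy).
by rewrite andbC => /(negP nxy).
Qed.

Hypothesis W_conn : forall S : {set V}, S \subset W -> S != finset.set0 -> S != W ->
  exists2 a, a \in S & exists2 b, b \in W :\: S & e a b.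

(** The path closes to a cycle through the forced pair. If it covers [W], deleting that pair opens
    it to a Hamilton path; otherwise an edge leaves it, and the cycle is opened next to the foot of
    that edge. *)
Lemma fpath_closed s : fpath e s -> e (last x s) (head x s) ->
  hampath e \/ exists2 s', fpath e s' & size s' = (size s).+1.
Proof.
move=> fs es; have /and4P[us aW ss ad] := fs.
have es_rev : e (last x (rev s)) (head x (rev s)).
  rewrite e_sym; case: s {fs us aW ss ad} es => [|a s] //=.
  rewrite rev_cons last_rcons; case: (lastP s) => [|t b] //=.
  by rewrite rev_rcons last_rcons.
have sW : [set v in s] \subset W by apply/subsetP => v; rewrite inE => /(allP aW).
have [E|nE] := eqVneq [set v in s] W; [left|right].
(* Reversal lets [x] come immediately before [y]. *)
- wlog xy : s us ad ss es es_rev E {fs aW sW} / (x, y) \in steps s.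
    move=> H; have [xy|yx] := orP ad; first exact: (H s).
    have yx' : (x, y) \in steps (rev s).
      by rewrite steps_rev mem_rev; apply/mapP; exists (y, x).
    apply: (H (rev s)); rewrite ?revK ?rev_uniq ?adjin_rev //.
      by rewrite sorted_rev_sym //; exact: rel_forced_sym.
    by apply/setP => v; rewrite inE mem_rev -E inE.
  case/steps_split: xy => s1 [s2 Es]; rewrite Es -cat_rcons in us ss es E.
  move: (us); rewrite cat_uniq => /and3P[u1 /hasPn h1 u2].
  have ns1 : ~~ ((x \in rcons s1 x) && (y \in rcons s1 x)).
    by rewrite negb_and (h1 y) ?orbT // inE eqxx.
  have ns2 : ~~ ((x \in y :: s2) && (y \in y :: s2)).
    rewrite negb_and; apply/orP; left; apply/negP => /h1.
    by rewrite /= mem_rcons inE eqxx.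
  exists (rev (y :: s2 ++ s1)).
  have ps : perm_eq (x :: rev (y :: s2 ++ s1)) (rcons s1 x ++ y :: s2).
    apply/permP => P; rewrite /= count_rev -cat_cons !count_cat -cats1 count_cat /=.
    by rewrite addn0 addnC addnAC [RHS]addnC addnA addnAC.
  split.
  + by rewrite (perm_uniq ps).
  + rewrite -rev_rcons sorted_rev_sym // rcons_cons rcons_cat -cat_cons.
    case Ec : (rcons s1 x) => [|c r]; first by case: (s1) Ec.
    rewrite Ec in ss es ns1; rewrite sorted_cat_cons in ss; case/andP: ss => ss1 ss2.
    rewrite sorted_cat_cons /= rcons_path.
    rewrite last_cat /= in es; rewrite es andbT.
    have := sorted_unforced ss2 ns2; rewrite /= => -> /=.
    apply: (sorted_unforced _ ns1); move: ss1; rewrite -cats1.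
    by rewrite -[_ ++ _]/(c :: r ++ [:: y]) /= cat_path => /andP[].
  + by rewrite rev_cons last_rcons.
  + by move=> v; rewrite (perm_mem ps) -E inE.
have xS : x \in s by have /adjin_mem/andP[] := ad.
have [|c] := W_conn sW _ nE; first by apply/set0Pn; exists x; rewrite inE.
rewrite inE => cs [z]; rewrite !inE => /andP[zs zW] ecz.
have [s1 [s2 Es]] : exists s1 s2, s = s1 ++ c :: s2.
  by case/splitPr: cs => s1 s2; exists s1, s2.
(* The cycle will be cut just before [c]. Up to reversal the forced pair lies in [c :: s2] and
   survives the cut. *)
wlog adc : s s1 s2 us aW ss es es_rev cs zs Es {fs ad sW nE xS} / adjin (c :: s2) x y.
  move=> H; move: (ad); rewrite {1}Es adjin_cat => /orP[ad'|]; last exact: (H s s1 s2).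
  have [|||||||||s' fs' zs'] := H (rev s) (rev s2) (rev s1).
  - by rewrite rev_uniq.
  - by rewrite all_rev.
  - by rewrite sorted_rev_sym //; exact: rel_forced_sym.
  - by [].
  - by rewrite revK.
  - by rewrite mem_rev.
  - by rewrite mem_rev.
  - by rewrite Es rev_cat rev_cons cat_rcons.
  - by rewrite -rev_rcons adjin_rev.
  by exists s' => //; rewrite zs' size_rev.
exists (z :: c :: s2 ++ s1); last first.
  by rewrite Es /= !size_cat /=; lia.
have ps : perm_eq (c :: s2 ++ s1) s by rewrite Es -cat_cons perm_catC.
rewrite Es in ss es; apply/and4P; split.
- by rewrite cons_uniq (perm_mem ps) zs (perm_uniq ps).
- by rewrite /= zW -/(all _ (c :: _)) (perm_all _ ps).
- rewrite /= {1}/rel_forced e_sym ecz /= -/(sorted (rel_forced e) (c :: _)).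
  move: ss; rewrite sorted_cat_cons => /andP[ss1 ss2].
  case: (s1) ss1 es => [|h t]; first by rewrite cats0.
  rewrite last_cat /= -cats1 cat_path => /andP[st _] es.
  rewrite -[path _ _ _]/(sorted (rel_forced e) ((c :: s2) ++ h :: t)) sorted_cat_cons [in X in _ && X]/= st andbT.
  rewrite /= rcons_path; apply/andP; split=> //.
  by rewrite /rel_forced es.
- rewrite {1}/adjin -[steps _]/((z, c) :: steps (c :: s2 ++ s1)) !inE.
  have : adjin (c :: s2 ++ s1) x y.
    case: (s1) => [|h t]; first by rewrite cats0.
    rewrite -cat_cons adjin_cat; apply/orP; left.
    by move: adc; rewrite /adjin lastI steps_rcons2 !mem_rcons !inE => /orP[]->; rewrite !orbT.
  by rewrite /adjin => /orP[]->; rewrite ?orbT.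
Qed.

End Rotation.
End Posa.

(** * Boosters *)

Section Boosters.
Variables (V : finType) (W : {set V}) (x y : V).
Hypothesis xy : x != y.
Hypothesis xW : x \in W.
Hypothesis yW : y \in W.
Implicit Types (e : rel V) (s : seq V) (p : V * V).

Lemma fpath_sub e e' s : subrel e e' -> fpath W x y e s -> fpath W x y e' s.
Proof.
move=> sub /and4P[us aW ss ad]; apply/and4P; split=> //.
by apply: sub_sorted ss => a b; rewrite /rel_forced => /orP[/sub ->|->]; rewrite ?orbT.
Qed.

Lemma hampath_sub e e' : subrel e e' -> hampath W x y e -> hampath W x y e'.
Proof. by move=> sub [s [us ss ls Ws]]; exists s; split=> //; apply: sub_path ss. Qed.

Lemma fpath_size e s : fpath W x y e s -> size s <= #|W|.
Proof.
case/and4P=> /card_uniqP <- /allP aW _ _; apply: subset_leq_card.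
by apply/subsetP => v /aW.
Qed.

Lemma fpath_xy e : fpath W x y e [:: x; y].
Proof.
by rewrite /fpath /= !inE xy xW yW /rel_forced /forced /adjin /= !inE !eqxx orbT.
Qed.

Definition longest e s := fpath W x y e s /\ forall s', fpath W x y e s' -> size s' <= size s.

Lemma longest_ex e s0 : fpath W x y e s0 -> exists2 s, longest e s & size s0 <= size s.
Proof.
move=> f0; pose P k := `[< exists2 s, fpath W x y e s & size s = k >].
have exP : exists k, P k by exists (size s0); apply/asboolP; exists s0.
have ubP k : P k -> k <= #|W| by case/asboolP => s /fpath_size + <-.
case: (ex_maxnP exP ubP) => k /asboolP[s fs sk] kmax.
exists s; first by split=> // s' fs'; rewrite sk; apply: kmax; apply/asboolP; exists s'.
by rewrite sk; apply: kmax; apply/asboolP; exists s0.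
Qed.

(** The pair is tested in every symmetric relation containing it and [e], so the augmented graph may
    be represented in any form. *)
Definition booster e k p := p.1 != p.2 /\
  forall e', symmetric e' -> subrel e e' -> e' p.1 p.2 ->
    hampath W x y e' \/ exists2 s, fpath W x y e' s & k < size s.

Section Count.
Variables (e : rel V) (U : {set V}) (beta : nat).
Hypothesis e_sym : symmetric e.
Hypothesis e_conn : forall S : {set V}, S \subset W -> S != finset.set0 -> S != W ->
  exists2 a, a \in S & exists2 b, b \in W :\: S & e a b.
Hypothesis e_exp : forall S : {set V}, S \subset W -> S != finset.set0 ->
  #|enbrs W e S| <= (#|S|).*2.+2 -> beta <= #|S :&: U|.

(** Rotate [s] until it ends at [q], reverse it, and rotate again with [q] as the fixed first
    vertex. Each end [r] so reached gives a longest path from [q] to [r], which the pair of [q] and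
    [r] closes. Both choices offer at least [beta] vertices of [U]. *)
Lemma booster_count s : longest e s ->
  beta * beta <= #|[set p : V * V | [&& p.1 \in U, p.2 \in U & `[< booster e (size s) p >]]]|.
Proof.
case=> fs smax.
have endsW t : fpath W x y e t -> size t = size s -> beta <= #|ends x y e t :&: U|.
  move=> ft st; apply: e_exp.
  - apply/subsetP => v; rewrite inE => /asboolP[t' rt <-].
    have [/and4P[_ /allP aW _ ad] _ _] := reach_fpath e_sym ft rt.
    have /adjin_mem/andP[xt _] := ad; apply: aW.
    by case: (t') xt => [|a l _] //; rewrite [last _ _]/= mem_last.
  - by apply/set0Pn; exists (last x t); apply: mem_ends; exact: reach0.
  - by apply: (posa e_sym) => // s'; rewrite st; exact: smax.
set P := [set p | _].
have key q : q \in ends x y e s :&: U -> beta <= \sum_(r | (q, r) \in P) 1.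
  rewrite inE => /andP[]; rewrite inE => /asboolP[t rt tq] qU.
  have [ft pt _] := reach_fpath e_sym fs rt.
  have ft' : fpath W x y e (rev t) by rewrite fpath_rev.
  have zt : size (rev t) = size s by rewrite size_rev (perm_size pt).
  apply: leq_trans (endsW _ ft' zt) _.
  rewrite sum1_card; apply: subset_leq_card; apply/subsetP => r.
  rewrite inE => /andP[]; rewrite inE => /asboolP[t' rt' t'r] rU.
  have [ft'' pt' ht'] := reach_fpath e_sym ft' rt'.
  have hq : head x t' = q.
    rewrite ht' -tq; case: (lastP t) => [|l c] //; by rewrite rev_rcons last_rcons.
  change (is_true ((q, r) \in P)); rewrite /P in_set /= qU rU /=; apply/asboolP; split=> /=.
    have /and4P[ut' _ _ /adjin_mem/andP[xt yt]] := ft''.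
    rewrite -hq -t'r; case: (t') ut' xt yt => [|a [|b l]] //=.
      by rewrite !inE => _ /eqP xa /eqP ya; move: xy; rewrite xa ya eqxx.
    by move=> /andP[al _] _ _; apply: contraNneq al => ->; exact: mem_last.
  move=> e' e'_sym sub e'qr.
  have ft3 := fpath_sub sub ft''.
  have [||h|[s' fs' zs']] := fpath_closed e'_sym _ ft3; [| |by left|].
  - move=> S SW S0 SnW; have [a aS [b bS ab]] := e_conn SW S0 SnW.
    by exists a => //; exists b => //; exact: sub.
  - by rewrite t'r hq e'_sym.
  by right; exists s' => //; rewrite zs' (perm_size pt') zt.
rewrite -sum1_card (eq_bigl (fun p => (p.1, p.2) \in P)); last by case.
rewrite -(pair_big_dep xpredT (fun q r => (q, r) \in P) (fun _ _ => 1)) /=.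
apply: leq_trans (_ : \sum_(q in ends x y e s :&: U) beta <= _).
  by rewrite sum_nat_const leq_mul2r endsW // orbT.
rewrite [leqLHS]big_mkcond; apply: leq_sum => q _; case: ifP => // /key; exact.
Qed.

End Count.

(** [Gamma t] is the current graph after adding the boosters in [t]. Each booster lengthens the
    longest path, so without a Hamilton path [#|W|.+1] of them would give a path longer than
    [#|W|]. *)
Lemma hampath_sprinkle (eG : rel V) (Gamma : seq (V * V) -> rel V) :
  (forall t, symmetric (Gamma t)) -> (forall p t, subrel (Gamma t) (Gamma (p :: t))) ->
  (forall p t, p.1 != p.2 -> Gamma (p :: t) p.1 p.2) ->
  (forall t, all (fun p => eG p.1 p.2) t -> subrel (Gamma t) eG) ->
  (forall t s, size t <= #|W| -> all (fun p => eG p.1 p.2) t -> ~ hampath W x y (Gamma t) ->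
    longest (Gamma t) s -> exists2 p, eG p.1 p.2 & booster (Gamma t) (size s) p) ->
  hampath W x y eG.
Proof.
move=> Gsym Gmono Gp GeG step; apply: contrapT => nham.
have nG t : all (fun p => eG p.1 p.2) t -> ~ hampath W x y (Gamma t).
  by move=> /GeG sub /(hampath_sub sub).
have H j : j <= #|W|.+1 -> exists t, [/\ size t = j, all (fun p => eG p.1 p.2) t &
    exists2 s, fpath W x y (Gamma t) s & j <= size s].
  elim: j => [|j IH] jW; first by exists [::]; split=> //; exists [:: x; y] => //; exact: fpath_xy.
  have [|t [zt at_ [s0 fs0 js0]]] := IH; first exact: ltnW.
  have [s ls s0s] := longest_ex fs0.
  have [|p ep [pn pb]] := step t s _ at_ (nG _ at_) ls; first by rewrite zt.
  exists (p :: t); split; rewrite /= ?zt ?ep //.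
  have ap : all (fun p => eG p.1 p.2) (p :: t) by rewrite /= ep.
  have [/(nG _ ap)//|[s' fs' ss']] := pb _ (Gsym _) (Gmono p t) (Gp _ _ pn).
  by exists s' => //; exact: leq_ltn_trans (leq_trans js0 s0s) ss'.
by have [t [_ _ [s /fpath_size h1 h2]]] := H _ (leqnn _); have := leq_trans h2 h1; rewrite ltnn.
Qed.

End Boosters.

(** * Expansion and connectivity from the edges touching [V2] *)

Section ExpanderConsequences.
Variables (V : finType) (W V2 : {set V}) (e1 e : rel V) (m K delta beta : nat).
Hypothesis e_sym : symmetric e.
Hypothesis sub : subrel e1 e.
Hypothesis m_gt0 : 0 < m.
Hypothesis joint1 : forall A B : {set V}, [disjoint A & B] -> m <= #|A| -> m <= #|B| ->
  (A \subset V2) || (B \subset V2) -> exists2 a, a \in A & exists2 b, b \in B & e1 a b.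
Hypothesis exp2 : forall A : {set V}, 0 < #|A| <= m ->
  (#|A|).*2 + 3 + K <= #|[set z in V2 | (z \notin A) && [exists v in A, e1 v z]]|.
Hypothesis V2W : #|V2 :\: W| <= K.
Hypothesis VW : #|~: W| <= delta.
Hypothesis size1 : 3 * (beta + #|V2|) + 3 + m + delta <= #|V|.
Hypothesis size2 : 3 * (beta + m) + 3 + m + K <= #|V2|.

(** The surplus [K] in [exp2] pays for the neighbours in [V2] that are missing from [W]. *)
Let small_exp (A : {set V}) : 0 < #|A| <= m -> (#|A|).*2.+2 < #|enbrs W e A|.
Proof.
move=> /exp2 h; set Z := [set z in V2 | _] in h.
have sZ : Z \subset enbrs W e A :|: (V2 :\: W).
  apply/subsetP => z; rewrite !inE => /and3P[zV zA /exists_inP[v vA vz]].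
  rewrite zV zA /= andbT; case: (z \in W) => //=; rewrite orbF.
  by apply/exists_inP; exists v => //; exact: sub.
have := leq_trans h (subset_leq_card sZ).
move/leq_trans/(_ (leq_trans (leq_card_setU _ _) (leq_add (leqnn _) V2W))).
by rewrite leq_add2r addn3.
Qed.

Let non_nbr (S B A : {set V}) : B \subset W -> [disjoint B & S] -> [disjoint B & enbrs W e S] ->
  A \subset S -> (A \subset V2) || (B \subset V2) -> m <= #|A| -> #|B| < m.
Proof.
move=> BW BS BE AS AB mA; rewrite ltnNge; apply/negP => mB.
have dAB : [disjoint A & B] by rewrite disjoint_sym; exact: disjointWr BS.
have [a aA [b bB ab]] := joint1 dAB mA mB AB.
have := disjointFr BE bB; rewrite inE (subsetP BW) // (disjointFr BS bB) /=.
by move/negbT/exists_inPn/(_ a (subsetP AS _ aA)); rewrite sub.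
Qed.

Let V2W_size : #|V2| <= #|V2 :&: W| + K.
Proof. by have := cardsID W V2; have := V2W; lia. Qed.

(** Poor expansion forces [S] above [m], so it has fewer than [m] non-neighbours: in all of [W] if
    [S] has [m] vertices in [V2], and otherwise in [V2]. Counting [W] with [size1], or [V2] with
    [size2], bounds [S] outside [V2] from below. *)
Lemma ends_large (S : {set V}) : S \subset W -> S != finset.set0 ->
  #|enbrs W e S| <= (#|S|).*2.+2 -> beta <= #|S :&: ~: V2|.
Proof.
move=> SW S0 nS; have Sm : m < #|S|.
  rewrite ltnNge; apply/negP => Sm; have := @small_exp S; rewrite Sm card_gt0 S0 => /(_ isT).
  by rewrite ltnNge nS.
have cS : #|S| = #|S :&: V2| + #|S :&: ~: V2| by rewrite -setDE cardsID.
have cover (X : {set V}) : X \subset W -> X \subset S :|: enbrs W e S :|: (X :\: S :\: enbrs W e S).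
  move=> XW; apply/subsetP => z zX; rewrite 2!in_setU 2!in_setD zX.
  by case: (z \in S); case: (z \in enbrs W e S).
have count (X : {set V}) : X \subset W -> #|X| <= #|S| + #|enbrs W e S| + #|X :\: S :\: enbrs W e S|.
  move=> /cover /subset_leq_card h; apply: leq_trans h (leq_trans (leq_card_setU _ _) _).
  by rewrite leq_add2r leq_card_setU.
have dis1 (X : {set V}) : [disjoint X :\: S :\: enbrs W e S & S].
  by rewrite -setI_eq0; apply/eqP/setP => z; rewrite in_setI 2!in_setD in_set0; case: (z \in S); rewrite ?andbF.
have dis2 (X : {set V}) : [disjoint X :\: S :\: enbrs W e S & enbrs W e S].
  by rewrite -setI_eq0; apply/eqP/setP => z; rewrite in_setI 2!in_setD in_set0; case: (z \in enbrs W e S); rewrite ?andbF.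
have [S2|S2] := leqP m #|S :&: V2|.
  have := @non_nbr S (W :\: S :\: enbrs W e S) (S :&: V2) _ (dis1 _) (dis2 _) (subsetIl _ _).
  rewrite subsetIr (subset_trans (subsetDl _ _) (subsetDl _ _)) => /(_ isT isT S2) hB.
  have := count W (subxx _).
  have := subset_leq_card (subsetIr S V2).
  have := cardsC W; have := VW; have := size1; lia.
have := @non_nbr S (V2 :&: W :\: S :\: enbrs W e S) S _ (dis1 _) (dis2 _) (subxx _).
have sub1 : V2 :&: W :\: S :\: enbrs W e S \subset V2 :&: W.
  exact: subset_trans (subsetDl _ _) (subsetDl _ _).
rewrite (subset_trans sub1 (subsetIr _ _)) (subset_trans sub1 (subsetIl _ _)) orbT.
move=> /(_ isT isT (ltnW Sm)) hB.
have := count _ (subsetIr V2 W).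
have := V2W_size; have := size2; lia.
Qed.

(** If no edge leaves [S], both sides have no outside neighbours and so exceed [m] by expansion. One
    of them has [m] vertices in [V2], and [joint1] yields an edge between them. *)
Lemma connected_in (S : {set V}) : S \subset W -> S != finset.set0 -> S != W ->
  exists2 a, a \in S & exists2 b, b \in W :\: S & e a b.
Proof.
move=> SW S0 SnW; have [/existsP[a /andP[aS /existsP[b /andP[bS ab]]]]|no] :=
    boolP [exists a, (a \in S) && [exists b, (b \in W :\: S) && e a b]].
  by exists a => //; exists b.
have noe a b : a \in S -> b \in W :\: S -> e a b = false.
  move=> aS bS; apply/negbTE; apply: contra no => ab.
  by apply/existsP; exists a; rewrite aS; apply/existsP; exists b; rewrite bS.
have T0 : W :\: S != finset.set0 by rewrite setD_eq0; apply: contra SnW => WS; rewrite eqEsubset SW.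
have eS : enbrs W e S = finset.set0.
  apply/setP => z; rewrite in_set0 inE; apply/negbTE; apply/and3P => -[zW zS /exists_inP[v vS]].
  by rewrite noe // inE zS.
have eT : enbrs W e (W :\: S) = finset.set0.
  apply/setP => z; rewrite in_set0 inE; apply/negbTE; apply/and3P => -[zW].
  rewrite inE zW andbT negbK => zS /exists_inP[v vS].
  by rewrite e_sym noe.
have big A : A != finset.set0 -> enbrs W e A = finset.set0 -> m < #|A|.
  move=> A0 eA; rewrite ltnNge; apply/negP => Am; have := @small_exp A.
  by rewrite card_gt0 A0 Am eA cards0 => /(_ isT).
have mS := big _ S0 eS; have mT := big _ T0 eT.
have dST : [disjoint S & W :\: S] by rewrite -setI_eq0 setIDA setDIl setDv set0I.
have [S2|S2] := leqP m #|S :&: V2|.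
  have [||||a aS [b bS ab]] := @joint1 (S :&: V2) (W :\: S).
  - by apply: disjointWl dST; exact: subsetIl.
  - by [].
  - exact: ltnW.
  - by rewrite subsetIr.
  by case/setIP: aS => aS _; have := sub ab; rewrite noe.
have T2 : m <= #|(W :\: S) :&: V2|.
  have : #|V2 :&: W| <= #|S :&: V2| + #|(W :\: S) :&: V2|.
    apply: leq_trans (leq_card_setU _ _); apply: subset_leq_card; apply/subsetP => z.
    by rewrite !inE => /andP[-> ->]; case: (z \in S).
  have := V2W_size; have := size2; lia.
have [||||a aS [b bS ab]] := @joint1 S ((W :\: S) :&: V2).
- by apply: disjointWr dST; exact: subsetIl.
- exact: ltnW.
- by [].
- by rewrite subsetIr orbT.
by case/setIP: bS => bS _; have := sub ab; rewrite noe.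
Qed.

End ExpanderConsequences.

(** * Hamilton cycles span the cycle space of a pseudorandom graph *)

Lemma steps_close (T : eqType) (c : seq T) : uniq c ->
  steps (close c) = [seq (v, next c v) | v <- c].
Proof.
case: c => [|x s] // us; have sz : size (steps (close (x :: s))) = (size s).+1.
  by rewrite /steps size_zip /= size_rcons minnC; apply/minn_idPl.
apply: (@eq_from_nth _ (x, x)); rewrite ?size_map ?sz // => i lti.
have nx : next (x :: s) (nth x (x :: s) i) = nth x s i.
  by rewrite next_nth mem_nth // index_uniq.
rewrite (nth_map x) // nx /steps nth_zip_cond -/(steps (close _)) sz lti.
rewrite [behead _]/= -[close _]rcons_cons nth_rcons lti nth_rcons.
by have [//|ges] := ltnP i (size s); rewrite (nth_default _ ges); case: ifP.
Qed.

Lemma size_flatten_const (T : Type) (d : nat) (qs : seq (seq T)) :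
  all (fun q => size q == d) qs -> size (flatten qs) = size qs * d.
Proof. by elim: qs => [|q qs IH] //= /andP[/eqP zq /IH h]; rewrite size_cat zq h mulSn. Qed.

Section EdgeVectors.
Variable n : nat.
Local Open Scope ring_scope.
Implicit Types (G : graph n) (c s : seq 'I_n).

Definition ev (x y : 'I_n) : edge_vect n := [ffun d : edge n => (val d == [set x; y])%:R].

Lemma evC x y : ev x y = ev y x.
Proof. by apply/ffunP => d; rewrite !ffunE setUC. Qed.

Lemma edge_vect_char2 (v : edge_vect n) : v + v = 0.
Proof.
apply/ffunP => d; rewrite !ffunE; apply/val_inj.
by case: (v d) => [[|[|[]]]] // ?.
Qed.

Lemma next_next_eq c x y : uniq c -> (2 < size c)%N -> x \in c -> y = next c x -> x = next c y -> False.
Proof.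
move=> uc sc xc; have [i c' rc] := rot_to xc.
rewrite -(next_rot i uc x) -(next_rot i uc y).
have : (2 < size (x :: c'))%N by rewrite -rc size_rot.
have : uniq (x :: c') by rewrite -rc rot_uniq.
rewrite rc; case: c' {rc} => [|a [|b c']] //= + _; rewrite eqxx !inE.
rewrite !negb_or => /and3P[/and3P[xa xb xc'] _ _] ->.
by rewrite eq_sym (negbTE xa) eqxx => xbE; rewrite -xbE eqxx in xb.
Qed.

(** With at least three vertices no edge is traversed twice, so nothing cancels. *)
Lemma psum_ev c : uniq c -> (2 < size c)%N -> psum ev (close c) = chi (cycle_edges c).
Proof.
move=> uc sc; rewrite /psum steps_close // big_map; apply/ffunP => d.
rewrite sum_ffunE !ffunE inE.
case: existsP => [[x /andP[xc /eqP dx]]|no].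
  rewrite (bigD1_seq x) //= ffunE dx eqxx big1_seq ?addr0 // => y /andP[yx yc].
  rewrite ffunE dx; case: eqP => // E; exfalso.
  have xin : x \in [set y; next c y] by rewrite -E !inE eqxx.
  have yin : y \in [set x; next c x] by rewrite E !inE eqxx.
  move: xin yin; rewrite !inE eq_sym (negbTE yx) /= => /eqP xy /eqP yxE.
  exact: next_next_eq uc sc xc yxE xy.
rewrite big1_seq // => y /andP[_ yc]; rewrite ffunE.
by case: eqP => // dy; case: no; exists y; rewrite yc dy eqxx.
Qed.

Lemma adj_sym G : symmetric (adj G).
Proof. by move=> x y; rewrite /adj; apply: eq_existsb => d; rewrite setUC. Qed.

Lemma adj_irr G : irreflexive (adj G).
Proof.
move=> x; apply/negbTE/negP => /existsP[d /andP[_ /eqP dx]].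
by have := valP d; rewrite /= dx setUid cards1.
Qed.

Lemma psum_potential (e : rel 'I_n) (M : zmodType) (g : 'I_n -> 'I_n -> M) a tau x s :
  (forall z : M, z + z = 0) -> (forall u v, e u v -> g u v = a u + a v + tau) ->
  sorted e (x :: s) -> psum g (x :: s) = a x + a (last x s) + tau *+ size s.
Proof.
move=> M2 ge; elim: s x => [|y s IH] x.
  by rewrite /psum big_nil M2 addr0.
move=> /= /andP[exy sy]; rewrite psum_cons2 IH // ge // mulrS.
by rewrite -!addrA; congr (_ + _); rewrite addrCA (addKx M2) addrCA.
Qed.

End EdgeVectors.

Section Deterministic.
Variables (n : nat) (G : graph n) (V2 : {set 'I_n}) (m l K delta B : nat).
Let e := adj G.
(** Trees grow only outside [V2]. The linking paths thus leave [V2] intact for the long path. *)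
Let N (u : 'I_n) := [set w in ~: V2 | e u w].
Hypothesis n_odd : odd n.
Hypothesis n_gt2 : 2 < n.
Hypothesis l_gt0 : 0 < l.
Hypothesis m_gt0 : 0 < m.
Hypothesis m_l : m <= 2 ^ l.
Hypothesis K_l : 8 * l + 12 <= K.
Hypothesis B_l : K + (3 * l + 3) * (l + l) + 2 ^ l.+1 + 2 ^ l.+2 <= B.
Hypothesis B_V1 : B + 7 * m < #|~: V2|.
Hypothesis delta_l : K + (3 * l + 3) * (l + l) <= delta.
Hypothesis expand1 : forall U : {set 'I_n}, 0 < #|U| <= m -> (#|U|).*2 + K <= #|nb N U|.
Hypothesis joint : forall A A' : {set 'I_n}, [disjoint A & A'] -> m <= #|A| -> m <= #|A'| ->
  exists2 u, u \in A & exists2 w, w \in A' & e u w.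
Hypothesis ham : forall (W : {set 'I_n}) x y, x != y -> x \in W -> y \in W ->
  #|V2 :\: W| <= K -> #|~: W| <= delta -> hampath W x y e.

(** Fewer than [m] vertices outside [V2] are neither in [U] nor neighbours of it. Of the [7m] in
    [B_V1], [2m] is for [U], [m] for these, and [4m] bounds twice the size of [U]. *)
Let wideB (X : {set 'I_n}) : #|X| <= B -> wide N m X.
Proof.
move=> XB U /andP[mU Um].
set Z := ~: V2 :\: U :\: nb N U.
have Zm : #|Z| < m.
  rewrite ltnNge; apply/negP => mZ.
  have dUZ : [disjoint U & Z].
    by rewrite -setI_eq0; apply/eqP/setP => z; rewrite in_setI 2!in_setD in_set0; case: (z \in U); rewrite ?andbF.
  have [u uU [w wZ uw]] := joint dUZ mU mZ.
  move: wZ; rewrite 2!in_setD => /and3P[/negP + _ wV]; apply.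
  by apply/bigcupP; exists u => //; rewrite inE wV.
have cover : ~: V2 \subset U :|: X :|: (nb N U :\: X) :|: Z.
  apply/subsetP => z zV; rewrite 3!in_setU 3!in_setD zV.
  by case: (z \in U); case: (z \in X); case: (z \in nb N U).
have c1 : #|~: V2| <= #|U| + #|X| + #|nb N U :\: X| + #|Z|.
  apply: leq_trans (subset_leq_card cover) _.
  do 3![apply: leq_trans (leq_card_setU _ _) _; rewrite leq_add2r ?leqnn //].
move: mU Um XB Zm c1 B_V1; set u := #|U|; set z := #|Z|; set v := #|~: V2|.
by set a := #|X|; set b := #|nb N U :\: X|; lia.
Qed.

(** Up to size [m] the surplus [K] of [expand1] absorbs [X]; beyond that [wideB] applies. *)
Let growable0 (X : {set 'I_n}) : #|X| <= K -> growable N m X [::].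
Proof.
move=> XK U Um; rewrite /used /= (_ : [set v in [::]] = finset.set0) ?setU0; last first.
  by apply/setP => v; rewrite !inE.
apply: leq_trans (leq_addr _ _).
have [U0|U0] := posnP #|U|; first by rewrite U0.
have [Um'|mU] := leqP #|U| m.
  have := @expand1 U; rewrite U0 Um' => /(_ isT).
  rewrite -(cardsID X (nb N U)) addnC => h.
  have := leq_trans h (leq_add (leq_trans (subset_leq_card (subsetIr _ _)) XK) (leqnn _)).
  by rewrite leq_add2l.
have XB : #|X| <= B by have := B_l; lia.
by apply: ltnW (wideB XB _); rewrite Um (ltnW mU).
Qed.

Let N_e u w : w \in N u -> e u w. Proof. by rewrite inE => /andP[]. Qed.

(** One link with trees of depths [l] and [l + b]; the Boolean fixes the parity. *)
Let short_path (X : {set 'I_n}) x y (b : bool) : x != y -> #|X| <= 8 * l + 10 ->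
  exists q, [/\ size q = (l.*2 + b)%N, uniq q,
    all (fun z => (z \notin X) && (z \notin [:: x; y])) q & sorted e (x :: rcons q y)].
Proof.
move=> xy Xl; pose X' := [set x; y] :|: X.
have cX' : #|X'| <= 8 * l + 12.
  apply: leq_trans (leq_card_setU _ _) _; rewrite cards2 xy.
  by rewrite (_ : 8 * l + 12 = 2 + (8 * l + 10)) ?leq_add2l //; lia.
have eb : 2 ^ (l + b).+1 <= 2 ^ l.+2 by rewrite leq_exp2l //; case: (b); lia.
have [||||||||qs [zqs aqs uqs nqs sqs]] :=
  @links _ N m B e m_gt0 wideB (adj_sym G) N_e joint X' [::] [:: (x, y)] l (l + b) l_gt0 _ m_l.
- by rewrite addn_gt0 l_gt0.
- by apply: leq_trans m_l _; rewrite leq_exp2l // leq_addr.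
- by [].
- by apply: growable0; exact: leq_trans cX' K_l.
- by rewrite /= inE xy.
- by move=> v; rewrite /= !inE => /orP[]->; rewrite ?orbT.
- by [].
- rewrite /= addn0 mul1n; apply: leq_trans B_l; apply: leq_add eb; rewrite leq_add2r.
  apply: leq_add; first exact: leq_trans cX' K_l.
  by have := leq_b1 b; have := l_gt0; nia.
case: qs zqs aqs uqs nqs sqs => [|q [|]] //= _; rewrite cats0 !andbT.
move=> /eqP zq uq nq sq; exists q; split=> //; first by rewrite zq -addnn addnA.
apply: sub_all nq => z /andP[]; rewrite usedE /= in_setU in_set2 orbF !negb_or.
by move=> /andP[/andP[-> ->] ->].
Qed.

Let U := kcycle_space n G.
(* [phi] has kernel [U], so it stands for the projection onto the quotient. *)
Let phi : 'End(edge_vect n) := (\1%VF - projv U)%R.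

Let phi0 v : (v \in U) = (phi v == 0%R).
Proof.
rewrite /phi add_lfunE opp_lfunE id_lfunE subr_eq0; apply/idP/eqP => [vU|->].
  by rewrite projv_id.
exact: memv_proj.
Qed.

Let g x y := phi (ev x y).

Let g_sym x y : g x y = g y x. Proof. by rewrite /g evC. Qed.

Let psum_g s : psum g s = phi (psum (@ev n) s).
Proof. by rewrite /psum linear_sum. Qed.

Let psum_ham h : uniq h -> size h = n -> cycle e h -> psum g (close h) = 0%R.
Proof.
move=> uh zh ch; rewrite psum_g psum_ev ?zh //; apply/eqP; rewrite -phi0.
apply/memv_span/fintype.imageP; exists (cycle_edges h) => //.
apply/existsP; have szh : size h == n by apply/eqP.
by exists (Tuple szh); rewrite /is_cycle /ucycleb /= zh n_gt2 ch uh eqxx.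
Qed.

Let short_even c : uniq c -> 2 < size c <= 6 * l + 8 -> ~~ odd (size c) -> cycle e c ->
  psum g (close c) = 0%R.
Proof.
move=> uc /andP[c2 cl] oc cc.
have [k sk] : exists k, size c = k.*2.
  by exists (size c)./2; rewrite -[LHS]odd_double_half (negbTE oc).
have k2 : 1 < k by lia.
have k3 : k <= 3 * l + 4 by lia.
have kk : k.-1 <= 3 * l + 3 by clear -k3; lia.
have [x [L [y [R [Ec zL zR]]]]] : exists x L y R, [/\ c = x :: L ++ y :: rev R,
    size L = k.-1 & size R = k.-1].
  case: c sk {uc c2 cl oc cc} => [|x r] sk; first by move: sk k2; case: (k).
  have sr : size r = k.*2.-1 by rewrite -sk.
  have lt1 : k.-1 < size r by rewrite sr; lia.
  exists x, (take k.-1 r), (nth x r k.-1), (rev (drop k r)); split.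
  - rewrite revK -{1}(cat_take_drop k.-1 r); congr (_ :: _ ++ _).
    by rewrite (drop_nth x) // prednK // ltnW.
  - by rewrite size_take lt1.
  - by rewrite size_rev size_drop sr; lia.
have ucc : uniq (x :: L ++ y :: R).
  by rewrite -(perm_uniq (_ : perm_eq c _)) // Ec perm_cons perm_cat2l perm_cons perm_rev.
pose X := [set v in c].
have XK : #|X| <= K.
  rewrite cardsE (leq_trans (card_size _)) // (leq_trans cl) // (leq_trans _ K_l) //; lia.
have zLR : size L = size R by rewrite zL zR.
have E1 : unzip1 (zip L R) = L by rewrite unzip1_zip // zLR.
have E2 : unzip2 (zip L R) = R by rewrite unzip2_zip // zLR.
have uLR : uniq (L ++ R).
  move: ucc; rewrite /= => /andP[_]; rewrite -cat_rcons -cats1 -catA.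
  by rewrite uniq_catCA cat_uniq => /and3P[].
have zps : size (zip L R) = k.-1 by rewrite size_zip zL zR minnn.
have [||||||qs [zqs aqs uqs nqs sqs]] :=
  @links _ N m B e m_gt0 wideB (adj_sym G) N_e joint X [::] (zip L R) l l l_gt0 l_gt0 m_l m_l.
- by [].
- exact: growable0.
- by rewrite E1 E2.
- move=> v; rewrite E1 E2 mem_cat /X in_set Ec inE [in X in _ -> X]mem_cat in_cons mem_rev.
  by case/orP=> ->; rewrite !orbT.
- by [].
- rewrite addn0 zps; apply: leq_trans B_l; apply: leq_add; last by rewrite leq_exp2l.
  by rewrite leq_add2r; apply: leq_add XK _; rewrite leq_mul2r kk orbT.
have zf : size (flatten qs) <= (3 * l + 3) * (l + l).
  by rewrite (size_flatten_const aqs) zqs zps leq_mul2r kk orbT.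
have inc v : (v \in c) = [|| v == x, v \in L, v == y | v \in R].
  by rewrite Ec inE mem_cat inE mem_rev.
have fl v : v \in flatten qs -> (v \notin c) && (v \notin V2).
  move=> /(allP nqs) /andP[]; rewrite usedE negb_or inE => /andP[-> _] /existsP[u].
  by rewrite !inE => /andP[-> _].
(* [T] consists of the rungs with their ends, and the long path must cover everything else. Rung
   interiors avoid [V2], so [V2] loses only vertices of the cycle, at most [K] of them. *)
pose T := L ++ R ++ flatten qs.
have uT : uniq T.
  rewrite /T catA cat_uniq uLR uqs andbT; apply/hasPn => v /fl /andP[+ _].
  rewrite inc !negb_or mem_cat => /and4P[_ vL _ vR].
  by rewrite negb_or vL vR.
pose W := ~: [set v in T].
have xyL : [/\ x != y, x \notin T & y \notin T].
  move: ucc; rewrite cons_uniq mem_cat inE !negb_or => /andP[/and3P[xL xy xR]].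
  rewrite cat_uniq /= negb_or => /and3P[_ /andP[yL _] /andP[yR _]].
  rewrite /T !mem_cat !negb_or xL xR yL yR xy; split=> //=;
  by apply/negP => /fl /andP[]; rewrite inc eqxx ?orbT.
have [xy xT yT] := xyL.
have [|||||s [us ss ls Ws]] := @ham W y x.
- by rewrite eq_sym.
- by rewrite !inE.
- by rewrite !inE.
- apply: leq_trans XK; apply: subset_leq_card; apply/subsetP => z.
  rewrite in_setD in_setC negbK !inE /T !mem_cat inc => /andP[/or3P[->|->|/fl /andP[_ /negP //]] _];
    by rewrite ?orbT.
- rewrite setCK cardsE (leq_trans (card_size _)) // /T !size_cat zL zR addnA.
  by apply: leq_trans delta_l; apply: leq_add zf; apply: leq_trans K_l; clear -k3; lia.
case: (lastP s) => [|s' z] in us ss ls Ws *; first by move: xy; rewrite -ls eqxx.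
rewrite last_rcons in ls; subst z.
have pT : perm_eq (x :: L ++ y :: R ++ flatten qs ++ s') (T ++ y :: rcons s' x).
  apply/permP => P; rewrite /T /= !count_cat /= !count_cat -cats1 count_cat /= addn0.
  rewrite addnC -!addnA; congr (_ + _); rewrite addnCA; congr (_ + _).
  by rewrite addnCA; congr (_ + _); rewrite addnCA; congr (_ + _).
have [|||h1 [h2 [[u1 z1 c1] [u2 z2 c2' E]]]] := @switch _ e _ g (adj_sym G) g_sym
    (@edge_vect_char2 n) x y L R qs s' (esym zLR) _ _ sqs ss.
- by rewrite zqs zps zL.
- by rewrite -Ec.
- apply: uniq_perm; rewrite ?enum_uniq //.
    rewrite (perm_uniq pT) cat_uniq uT us andbT andTb; apply/hasPn => v.
    by rewrite Ws in_setC inE.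
  by move=> v; rewrite (perm_mem pT) mem_cat Ws mem_enum in_setC !inE orbN.
by rewrite Ec E !psum_ham ?addr0 ?z1 ?z2 ?card_ord.
Qed.

Lemma kcycle_space_full : kcycle_space n G == cycle_space G.
Proof.
rewrite eqEsubv; apply/andP; split; apply/span_subvP => v /fintype.imageP[D] /=.
  move=> /existsP[c /andP[cG /eqP ->]] ->; exact: mem_cycle_space.
move=> /existsP[k /existsP[c /andP[/andP[sc /andP[cc uc]] /eqP ->]]] ->.
rewrite phi0 -psum_ev // -psum_g; move: sc cc uc; move: (tval c) => {D c} c sc cc uc.
case: c sc cc uc => [|x [|y c]] // sc cc uc.
have exy : e x y by move: cc => /= /andP[].
have xy : x != y by apply: contraTneq exy => ->; rewrite /e adj_irr.
have [a [tau gE]] := @potential 'I_n e _ g l (adj_sym G) (@adj_irr n G) g_sym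
  (@edge_vect_char2 n) l_gt0 short_even short_path x y xy.
have closeE d : cycle e d -> psum g (close d) = (tau *+ size d)%R.
  case: d => [|z d]; first by rewrite /psum big_nil.
  rewrite cycle_close /close rcons_cons => sd.
  rewrite (psum_potential (@edge_vect_char2 n) gE sd) last_rcons size_rcons.
  by rewrite edge_vect_char2 add0r.
(* A Hamilton path between the ends of the edge [x y] closes to a Hamilton cycle. *)
have [||||s [us ss ls Ws]] := @ham [set: 'I_n] x y xy; rewrite ?inE //.
- by rewrite setDT cards0.
- by rewrite setCT cards0.
have tau0 : tau = 0%R.
  have ch : cycle e (x :: s).
    by rewrite /= rcons_path ls; move: ss => /= ->; rewrite /e adj_sym.
  have zs : size (x :: s) = n.
    by rewrite -(card_uniqP us) (eq_card Ws) cardsT card_ord.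
  have := psum_ham us zs ch; rewrite closeE // zs => h.
  have n2 i : odd i -> (tau *+ i = tau)%R.
    move=> oi; rewrite -[i in LHS]odd_double_half oi -muln2 mulrnDr mulrnA mulr2n.
    by rewrite edge_vect_char2 addr0.
  by rewrite n2 in h.
by rewrite closeE // tau0 mul0rn.
Qed.

End Deterministic.

(** * Probability estimates *)

Import Order.TTheory Num.Theory.

Section Gnp.
Local Open Scope ring_scope.
Variables (R : realType) (n : nat) (p : R).
Hypothesis p01 : 0 <= p <= 1.
Implicit Types (G H T D K : {set edge n}) (P Q : pred (graph n)).

Let q := 1 - p.
Let q_ge0 : 0 <= q. Proof. by rewrite subr_ge0; case/andP: p01. Qed.
Let p_ge0 : 0 <= p. Proof. by case/andP: p01. Qed.

Lemma sum_graph_prod (a b : edge n -> R) :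
  \sum_(G : graph n) \prod_e (if e \in G then a e else b e) = \prod_e (a e + b e).
Proof. by rewrite bigA_distr; apply: eq_bigl. Qed.

Lemma gnp_prob_le P Q : {subset P <= Q} -> gnp_prob p P <= gnp_prob p Q.
Proof.
move=> PQ; rewrite /gnp_prob [leLHS]big_mkcond [leRHS]big_mkcond ler_sum //= => G _.
case: ifP => [/PQ|_]; first by rewrite unfold_in => ->.
by case: ifP => // _; exact: gnp_mass_ge0.
Qed.

Lemma gnp_prob_le1 P : gnp_prob p P <= 1.
Proof. by rewrite -(gnp_probT n p); apply: gnp_prob_le. Qed.

Lemma gnp_probC P : gnp_prob p P = 1 - gnp_prob p (predC P).
Proof. by rewrite -(gnp_probT n p) /gnp_prob [X in X - _](bigID P) /= addrK. Qed.

Lemma gnp_probU P Q : gnp_prob p [pred G | P G || Q G] <= gnp_prob p P + gnp_prob p Q.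
Proof.
rewrite /gnp_prob [leLHS]big_mkcond [X in X + _]big_mkcond [X in _ + X]big_mkcond -big_split.
apply: ler_sum => G _ /=; have := gnp_mass_ge0 G p01.
by case: (P G); case: (Q G) => //= h; rewrite ?addr0 ?add0r ?lerDl.
Qed.

Lemma gnp_prob_exists (I : finType) (J : pred I) (P : I -> pred (graph n)) :
  gnp_prob p [pred G | [exists i in J, P i G]] <= \sum_(i in J) gnp_prob p (P i).
Proof.
apply: le_trans (_ : \sum_(G : graph n) \sum_(i in J) (if P i G then gnp_mass p G else 0) <= _).
  rewrite /gnp_prob big_mkcond ler_sum //= => G _; case: ifP => [/exists_inP[i iJ Pi]|_].
    rewrite (bigD1 i) //= Pi lerDl sumr_ge0 // => j _; case: ifP => // _.
    exact: gnp_mass_ge0.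
  by apply: sumr_ge0 => i _; case: ifP => // _; exact: gnp_mass_ge0.
by rewrite exchange_big /=; apply: ler_sum => i _; rewrite /gnp_prob -big_mkcond.
Qed.

Lemma gnp_cylinder K H D : H \subset K -> [disjoint D & K] ->
  \sum_(G : graph n | (G :&: K == H) && [disjoint G & D]) gnp_mass p G =
  (\prod_(e in K) (if e \in H then p else q)) * q ^+ #|D|.
Proof.
move=> HK DK.
(* The conditions on [G] become weights: a forbidden state of an edge has weight zero, so the sum
   over all graphs factors over edges. *)
pose a e := if e \in K then (if e \in H then p else 0) else (if e \in D then 0 else p).
pose b e := if e \in K then (if e \in H then 0 else q) else q.
have -> : \sum_(G : graph n | (G :&: K == H) && [disjoint G & D]) gnp_mass p G =
    \sum_(G : graph n) \prod_e (if e \in G then a e else b e).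
  rewrite [LHS]big_mkcond; apply: eq_bigr => G _.
  pose ok e := ((e \in K) ==> ((e \in G) == (e \in H))) && ~~ ((e \in G) && (e \in D)).
  have [/forallP all_ok|/forallPn[e]] := boolP [forall e, ok e].
    rewrite ifT; last first.
      apply/andP; split.
        apply/eqP/setP => e; rewrite inE; have /andP[/implyP h _] := all_ok e.
        have [eK|eK] := boolP (e \in K); first by rewrite andbT (eqP (h eK)).
        by rewrite andbF; apply/esym; apply: contraNF eK; exact: (subsetP HK).
      rewrite -setI_eq0; apply/eqP/setP => e; rewrite inE in_set0.
      by have /andP[_ /negbTE] := all_ok e.
    apply: eq_bigr => e _; rewrite /a /b; have /andP[/implyP h1 h2] := all_ok e.
    have [eK|eK] := boolP (e \in K); first by rewrite (eqP (h1 eK)); case: (e \in H).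
    by move: h2; case: (e \in G) => //= /negbTE ->.
  move=> nok; rewrite ifF; last first.
    apply/negbTE; apply: contra nok; rewrite /ok => /andP[/eqP <- dGD].
    rewrite inE; have [eG|eG] := boolP (e \in G).
      by rewrite (disjointFr dGD eG) andbT; apply/implyP => ->.
    by rewrite /= eqxx implybT.
  apply/esym/eqP; rewrite prodf_seq_eq0; apply/hasP; exists e; first exact: mem_index_enum.
  move: nok; rewrite /ok negb_and negbK negb_imply /a /b /=.
  case/orP=> [/andP[eK]|/andP[eG eD]].
    by rewrite eK; case: (e \in G); case: (e \in H).
  by rewrite eG (disjointFr DK eD) eD.
rewrite sum_graph_prod (bigID (mem K)) /=; congr (_ * _).
  apply: eq_bigr => e eK; rewrite /a /b eK; case: (e \in H); first by rewrite addr0.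
  by rewrite add0r.
transitivity (\prod_(e in D) q); last by rewrite prodr_const.
rewrite big_mkcond [RHS]big_mkcond; apply: eq_bigr => e _; rewrite /a /b /=.
have [eD|eD] := boolP (e \in D); first by rewrite (disjointFr DK eD) /= add0r.
by case: (e \in K) => //=; rewrite /q addrC subrK.
Qed.

(* [D (G :&: K)] depends only on the edges inside [K] and avoids [K], hence is independent
   of the edges outside [K]. *)
Lemma gnp_miss K (D : graph n -> {set edge n}) (b : nat) : (forall H, [disjoint D H & K]) ->
  gnp_prob p [pred G : graph n | (b <= #|D (G :&: K)|)%N && [disjoint G & D (G :&: K)]] <= q ^+ b.
Proof.
move=> DK; rewrite /gnp_prob.
rewrite (partition_big (fun G : graph n => G :&: K) (fun H => H \subset K)) /=; last first.
  by move=> G _; exact: subsetIr.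
have one : \sum_(H : graph n | H \subset K) \prod_(e in K) (if e \in H then p else q) = 1.
  rewrite [LHS](eq_bigr (fun H => \sum_(G : graph n | (G :&: K == H) && [disjoint G & finset.set0])
      gnp_mass p G)); last first.
    move=> H HK; rewrite gnp_cylinder ?cards0 ?expr0 ?mulr1 //.
    by rewrite -setI_eq0 set0I.
  rewrite -(gnp_probT n p) /gnp_prob.
  rewrite [RHS](partition_big (fun G : graph n => G :&: K) (fun H => H \subset K)) /=; last first.
    by move=> G _; exact: subsetIr.
  apply: eq_bigr => H _; apply: eq_bigl => G.
  by rewrite -setI_eq0 setI0 eqxx andbT.
rewrite -[leRHS]mul1r -one mulr_suml; apply: ler_sum => H HK.
have w_ge0 : 0 <= \prod_(e in K) (if e \in H then p else q).
  by apply: prodr_ge0 => e _; case: ifP.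
have [bD|bD] := leqP b #|D H|; last first.
  rewrite big1 ?mulr_ge0 ?exprn_ge0 // => G /andP[/andP[h _] /eqP E].
  by move: h; rewrite E leqNgt bD.
apply: le_trans (_ : \sum_(G : graph n | (G :&: K == H) && [disjoint G & D H]) gnp_mass p G <= _).
  rewrite [leLHS]big_mkcond [leRHS]big_mkcond; apply: ler_sum => G _.
  case: ifP => [/andP[/andP[_ dG] /eqP E]|_]; first by rewrite E eqxx -{1}E dG.
  by case: ifP => // _; exact: gnp_mass_ge0.
rewrite gnp_cylinder //; apply: ler_wpM2l => //.
by apply: ler_wiXn2l => //; rewrite gerBl.
Qed.

Lemma gnp_miss1 T : gnp_prob p [pred G : graph n | [disjoint G & T]] <= q ^+ #|T|.
Proof.
apply: le_trans (@gnp_miss finset.set0 (fun=> T) #|T| _); last first.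
  by move=> H; rewrite disjoint_sym -setI_eq0 set0I.
by apply: gnp_prob_le => G; rewrite !inE leqnn.
Qed.

(* Markov's inequality for [2 ^- #|G :&: T|]. *)
Lemma gnp_few T (s : nat) :
  gnp_prob p [pred G : graph n | (#|G :&: T| <= s)%N] <= 2 ^+ s * (1 - p / 2) ^+ #|T|.
Proof.
pose a e := if e \in T then p / 2 else p.
apply: le_trans (_ : 2 ^+ s * \sum_(G : graph n) \prod_e (if e \in G then a e else q) <= _).
  rewrite mulr_sumr /gnp_prob [leLHS]big_mkcond; apply: ler_sum => G _.
  have E : \prod_e (if e \in G then a e else q) = gnp_mass p G * 2^-1 ^+ #|G :&: T|.
    rewrite -prodr_const [X in _ * X]big_mkcond /gnp_mass -big_split; apply: eq_bigr => e _ /=.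
    by rewrite !inE /a; case: (e \in G); case: (e \in T); rewrite ?mulr1.
  rewrite E mulrCA; case: ifP => [Gs|_]; last first.
    by rewrite mulr_ge0 ?gnp_mass_ge0 // mulr_ge0 ?exprn_ge0 ?invr_ge0 ?ler0n.
  rewrite -[leLHS]mulr1; apply: ler_wpM2l; first exact: gnp_mass_ge0.
  rewrite exprVn -(subnK Gs) exprD mulfK ?expf_neq0 ?pnatr_eq0 //.
  by rewrite exprn_ege1 // ler1n.
rewrite ler_wpM2l ?exprn_ge0 // sum_graph_prod (bigID (mem T)) /=.
rewrite [X in _ * X]big1 ?mulr1 => [|e /negbTE eT]; last by rewrite /a eT /q addrC subrK.
rewrite (eq_bigr (fun=> 1 - p / 2)) ?prodr_const // => e eT; rewrite /a eT /q.
by rewrite addrC -addrA; congr (_ + _); rewrite {1}(splitr p) opprD addrNK.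
Qed.

End Gnp.

(** Such a set is the set of entries of a [k]-tuple, padded by repeating one of its elements. *)
Lemma card_small_sets (T : finType) k :
  #|[set Y : {set T} | 0 < #|Y| <= k]| <= #|T| ^ k.
Proof.
rewrite -card_tuple.
apply: leq_trans (_ : #|[set [set x in t] | t : k.-tuple T]| <= _); last exact: leq_imset_card.
apply: subset_leq_card; apply/subsetP => Y; rewrite inE => /andP[Y0 Yk].
have [y yY] : exists y, y \in Y by apply/set0Pn; rewrite -card_gt0.
have sz : size (enum Y ++ nseq (k - #|Y|) y) == k by rewrite size_cat size_nseq -cardE subnKC.
apply/imsetP; exists (Tuple sz) => //; apply/setP => x; rewrite inE mem_cat mem_enum mem_nseq.
by case: eqP => [->|]; rewrite ?yY // andbF orbF.
Qed.

Lemma card_sets (T : finType) : #|{: {set T}}| = 2 ^ #|T|.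
Proof.
by rewrite -cardsT -card_powerset; apply: eq_card => A; rewrite !inE subsetT.
Qed.

Section Between.
Variable n : nat.
Implicit Types (A B : {set 'I_n}) (G : graph n).

Definition between A B : {set edge n} :=
  [set d | [exists a in A, [exists b in B, val d == [set a; b]]]].

Lemma card_between A B : [disjoint A & B] -> #|A| * #|B| <= #|between A B|.
Proof.
move=> dAB; rewrite -cardsX.
have inj : {in setX A B &, injective (fun ab : 'I_n * 'I_n => [set ab.1; ab.2])}.
  move=> [a b] [a' b']; rewrite !in_setX /= => /andP[aA bB] /andP[aA' bB'] E.
  have : a \in [set a'; b'] by rewrite -E !inE eqxx.
  have : b \in [set a'; b'] by rewrite -E !inE eqxx orbT.
  rewrite !inE => /orP[/eqP bE|/eqP ->] /orP[/eqP ->|/eqP aE] //.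
  - by have := disjointFr dAB aA'; rewrite -bE bB.
  - by have := disjointFr dAB aA; rewrite aE bB'.
  - by have := disjointFr dAB aA; rewrite aE bB'.
rewrite -(card_in_imset inj).
apply: leq_trans (leq_imset_card val (mem (between A B))); apply: subset_leq_card.
apply/subsetP => s /imsetP[[a b] /setXP[/= aA bB] ->].
have ab : a != b by apply: contraTneq aA => ->; rewrite (disjointFl dAB bB).
have h : #|[set a; b]| == 2 by rewrite cards2 ab.
apply/imsetP; exists (Sub [set a; b] h); rewrite ?SubK // inE SubK.
by apply/exists_inP; exists a => //; apply/exists_inP; exists b.
Qed.

Lemma betweenP G A B : ~~ [disjoint G & between A B] ->
  exists2 a, a \in A & exists2 b, b \in B & adj G a b.
Proof.
rewrite -setI_eq0 => /set0Pn[d]; rewrite !inE => /andP[dG /exists_inP[a aA /exists_inP[b bB /eqP E]]].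
by exists a => //; exists b => //; apply/existsP; exists d; rewrite dG E eqxx.
Qed.

Lemma card_star G v (S : {set 'I_n}) :
  #|G :&: between [set v] S| <= #|[set w in S | adj G v w]|.
Proof.
rewrite -(card_imset _ val_inj).
apply: leq_trans (leq_imset_card (fun w => [set v; w]) (mem [set w in S | adj G v w])).
apply: subset_leq_card; apply/subsetP => s /imsetP[d + ->].
rewrite !inE => /andP[dG /exists_inP[a /set1P -> /exists_inP[w wS /eqP E]]].
apply/imsetP; exists w => //; rewrite inE wS; apply/existsP; exists d.
by rewrite dG E eqxx.
Qed.

End Between.

(** * Union bounds for the bad events *)

Section Events.
Local Open Scope ring_scope.
Variables (R : realType) (n : nat) (p : R) (m c c' : nat).
Hypothesis p01 : 0 <= p <= 1.
Hypothesis m_ge : (64 <= m)%N.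
Hypothesis n_m : (64 * m <= n <= 65 * m)%N.
Let q := 1 - p.
Let q' := 1 - p / 2.
Hypothesis q_n : n%:R ^+ c * q ^+ n <= 1.
Hypothesis q'_n : n%:R ^+ c' * q' ^+ n <= 1.
Hypothesis c_ge : (66 * 66 <= c)%N.
Hypothesis c'_ge : (800 <= c')%N.

Let n_gt0 : (0 < n)%N. Proof. by move: m_ge n_m; clear; lia. Qed.
Let nR_gt0 : 0 < n%:R :> R. Proof. by rewrite ltr0n. Qed.

(* All estimates reduce to comparing exponents: [q ^+ n] is at most [n ^- a]. *)
Lemma pow_bound (x : R) (a k N : nat) : 0 <= x -> n%:R ^+ a * x ^+ n <= 1 ->
  (k * n <= a * N)%N -> n%:R ^+ k * x ^+ N <= 1.
Proof.
move=> x0 xn kN; rewrite -(@expr_le1 _ n) ?mulr_ge0 ?exprn_ge0 ?ler0n //.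
apply: le_trans (_ : (n%:R ^+ a * x ^+ n) ^+ N <= 1); last first.
  by rewrite exprn_ile1 // mulr_ge0 ?exprn_ge0.
rewrite !exprMn -!exprM [(n * N)%N]mulnC ler_wpM2r ?exprn_ge0 //.
by rewrite ler_weXn2l // ler1n.
Qed.

Let q_ge0 : 0 <= q. Proof. by rewrite subr_ge0; case/andP: p01. Qed.
Let q_le1 : q <= 1. Proof. by rewrite gerBl; case/andP: p01. Qed.
Let q'_ge0 : 0 <= q'.
Proof.
rewrite subr_ge0 ler_pdivrMr // mul1r; case/andP: p01 => _ p1.
by apply: le_trans p1 _; rewrite ler1n.
Qed.
Let q'_le1 : q' <= 1. Proof. by rewrite gerBl divr_ge0 //; case/andP: p01. Qed.

Let le_inv (x : R) : n%:R * x <= 1 -> x <= n%:R^-1.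
Proof. by rewrite -[n%:R^-1]mul1r ler_pdivlMr // mulrC. Qed.

(** Union bound over [v] with [gnp_few]; at least [15m] possible edges join [v] to the rest of
    [S]. *)
Lemma prob_low_degree (S : {set 'I_n}) (s : nat) : (16 * m <= #|S|)%N -> (2 ^ s <= n ^ 88)%N ->
  gnp_prob p [pred G : graph n | [exists v in 'I_n, (#|[set w in S | adj G v w]| <= s)%N]] <= n%:R^-1.
Proof.
move=> Sm sn; apply: le_trans (gnp_prob_exists p01 _ _) _.
have bound (v : 'I_n) :
    gnp_prob p [pred G : graph n | (#|[set w in S | adj G v w]| <= s)%N] <= n%:R ^+ 88 * q' ^+ (15 * m).
  apply: le_trans (_ : gnp_prob p [pred G : graph n | (#|G :&: between [set v] (S :\ v)| <= s)%N] <= _).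
    apply: gnp_prob_le => // G; rewrite !inE; apply: leq_trans.
    apply: leq_trans (card_star _ _ _) _; apply: subset_leq_card.
    by apply/subsetP => w; rewrite !inE => /andP[/andP[_ ->] ->].
  apply: le_trans (gnp_few p01 _ _) _; apply: ler_pM; rewrite ?exprn_ge0 //.
    by rewrite -!natrX ler_nat.
  apply: ler_wiXn2l => //; have := @card_between n [set v] (S :\ v).
  rewrite cards1 mul1n => /(_ _); rewrite disjoints1 !inE eqxx => /(_ isT); apply: leq_trans.
  by move: Sm m_ge (leq_b1 (v \in S)); rewrite (cardsD1 v S); clear; set k := #|_|; lia.
apply: le_trans (ler_sum _ (fun v _ => bound v)) _.
rewrite sumr_const card_ord -[leLHS]mulr_natl; apply: le_inv.
rewrite (mulrA _ (_ ^+ 88)) -exprS mulrA -exprS; apply: (pow_bound q'_ge0 q'_n).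
by move: m_ge n_m c'_ge; clear; nia.
Qed.

(** [Y] stands for [A] with its neighbours in [S]. At least [12m] vertices of [S] lie outside [Y],
    and there are at most [n ^ (4 #|A|)] choices of [Y], so each [A] contributes at most [z ^ #|A|].
    Summing over sizes of [A] gives at most [(n + 1) n z], and [z] is at most [n ^- 4]. *)
Lemma prob_no_expansion (S : {set 'I_n}) : (16 * m <= #|S|)%N ->
  gnp_prob p [pred G : graph n | [exists AY : {set 'I_n} * {set 'I_n} in
      [pred AY : {set 'I_n} * {set 'I_n} | [&& (0 < #|AY.1| <= m)%N, AY.1 \subset AY.2 & (#|AY.2| <= 4 * #|AY.1|)%N]],
      [disjoint G & between AY.1 (S :\: AY.2)]]] <= n%:R^-1.
Proof.
move=> Sm; apply: le_trans (gnp_prob_exists p01 _ _) _.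
pose z := n%:R ^+ 4 * q ^+ (12 * m).
have z0 : 0 <= z by rewrite mulr_ge0 ?exprn_ge0.
have zn : n%:R ^+ 4 * z <= 1.
  rewrite mulrA -exprD; apply: (pow_bound q_ge0 q_n).
  by move: m_ge n_m c_ge; clear; nia.
apply: le_trans (_ : \sum_(A : {set 'I_n} | (0 < #|A|)%N)
    \sum_(Y : {set 'I_n} | (0 < #|Y| <= 4 * #|A|)%N) (q ^+ (12 * m)) ^+ #|A| <= _).
  rewrite [leRHS]pair_big_dep /= [leLHS]big_mkcond [leRHS]big_mkcond; apply: ler_sum => -[A Y] _ /=.
  case: ifP => [/and3P[/andP[A0 Am] AY YA]|_]; last first.
    by case: ifP => // _; rewrite !exprn_ge0.
  rewrite A0 YA (leq_trans A0 (subset_leq_card AY)) /=.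
  apply: le_trans (gnp_miss1 p01 _) _; rewrite -exprM; apply: ler_wiXn2l => //.
  have dA : [disjoint A & S :\: Y].
    by rewrite disjoints_subset; apply/subsetP => x /(subsetP AY) xY; rewrite !inE xY.
  apply: leq_trans (card_between dA); rewrite mulnC leq_mul2l; apply/orP; right.
  have h := leq_trans (subset_leq_card (subsetIr S Y)) YA.
  rewrite cardsD; move: Sm Am h; clear; set i := #|_ :&: _|; set j := #|S|; set k := #|A|; lia.
apply: le_trans (_ : \sum_(A : {set 'I_n} | (0 < #|A|)%N) z ^+ #|A| <= _).
  apply: ler_sum => A A0; rewrite sumr_const -[leLHS]mulr_natl /z exprMn.
  rewrite ler_wpM2r ?exprn_ge0 // -exprM -natrX ler_nat.
  have := @card_small_sets 'I_n (4 * #|A|); rewrite card_ord cardsE; exact: leq_trans.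
rewrite (partition_big (fun A : {set 'I_n} => inord #|A| : 'I_n.+1) (fun a => (0 < a)%N)) /=; last first.
  move=> A A0; rewrite inordK // ltnS -[leqRHS]card_ord; exact: max_card.
apply: le_trans (_ : \sum_(a : 'I_n.+1 | (0 < a)%N) n%:R * z <= _).
  apply: ler_sum => a a0.
  apply: le_trans (_ : \sum_(A in [set Y : {set 'I_n} | (0 < #|Y| <= a)%N]) z ^+ a <= _).
    rewrite [leLHS]big_mkcond [leRHS]big_mkcond; apply: ler_sum => A _; rewrite inE.
    case: ifP => [/andP[A0 /eqP Aa]|_]; last by case: ifP => // _; rewrite exprn_ge0.
    have Aa' : #|A| = a by rewrite -Aa inordK // ltnS -[leqRHS]card_ord; exact: max_card.
    by rewrite A0 Aa' leqnn.
  rewrite sumr_const -[leLHS]mulr_natl.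
  apply: le_trans (_ : (n%:R * z) ^+ a <= _).
    rewrite [leRHS]exprMn ler_wpM2r ?exprn_ge0 // -natrX ler_nat.
    by have := @card_small_sets 'I_n a; rewrite card_ord.
  have nz1 : n%:R * z <= 1.
    apply: le_trans zn; rewrite ler_wpM2r // -[leLHS]expr1 ler_weXn2l // ler1n //.
  rewrite -[leRHS]expr1; apply: ler_wiXn2l => //; by rewrite mulr_ge0.
apply: le_inv; apply: le_trans zn; clearbody z.
apply: le_trans (_ : n%:R * (n.+1%:R * (n%:R * z)) <= _).
  have -> : n.+1%:R * (n%:R * z) = \sum_(a : 'I_n.+1) n%:R * z.
    by rewrite sumr_const card_ord [LHS]mulr_natl.
  rewrite ler_wpM2l // [leLHS]big_mkcond; apply: ler_sum => a _; case: ifP => // _; exact: mulr_ge0.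
rewrite !mulrA ler_wpM2r // -natrX -!natrM ler_nat.
rewrite !expnS expn0 muln1 -!mulnA leq_mul2l [leqRHS]mulnA leq_mul2r.
by apply/orP; right; apply/orP; right; move: m_ge n_m; clear; nia.
Qed.

(** There are at most [4 ^ n <= n ^ n] pairs of sets, each missing at least [m * m] edges. The bound
    [66 * 66] on [c] comes from [n + 1 <= 66 m]. *)
Lemma prob_not_joint :
  gnp_prob p [pred G : graph n | [exists AB : {set 'I_n} * {set 'I_n} in
      [pred AB : {set 'I_n} * {set 'I_n} | [&& [disjoint AB.1 & AB.2], (m <= #|AB.1|)%N & (m <= #|AB.2|)%N]],
      [disjoint G & between AB.1 AB.2]]] <= n%:R^-1.
Proof.
apply: le_trans (gnp_prob_exists p01 _ _) _.
apply: le_trans (_ : \sum_(AB : {set 'I_n} * {set 'I_n}) q ^+ (m * m) <= _).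
  rewrite [leLHS]big_mkcond; apply: ler_sum => -[A B] _ /=.
  case: ifP => [/and3P[dAB Am Bm]|_]; last exact: exprn_ge0.
  apply: le_trans (gnp_miss1 p01 _) _; apply: ler_wiXn2l => //.
  by apply: leq_trans (card_between dAB); exact: leq_mul.
rewrite sumr_const -[leLHS]mulr_natl; apply: le_inv; rewrite mulrA.
apply: le_trans (_ : n%:R ^+ n.+1 * q ^+ (m * m) <= _).
  rewrite ler_wpM2r ?exprn_ge0 // -natrX -natrM ler_nat card_prod card_sets card_ord expnS.
  rewrite leq_mul2l -expnMn leq_exp2r //; apply/orP; right; move: m_ge n_m; clear; lia.
apply: (pow_bound q_ge0 q_n); have h : (n.+1 * n <= 66 * m * (66 * m))%N.
  by apply: leq_mul; move: m_ge n_m; clear; lia.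
apply: leq_trans h _; rewrite mulnACA leq_mul2r c_ge orbT //.
Qed.

(** A union bound over the indices: given the edges in [K], each failure has probability at most
    [q ^+ b], and [b] is quadratic in [n]. *)
Lemma prob_no_sprinkle (I : finType) (K : {set edge n}) (D : I -> graph n -> {set edge n}) (b : nat) :
  (#|I| <= n ^ (4 * n).-1)%N -> (4 * (m * m) <= b)%N -> (forall i H, [disjoint D i H & K]) ->
  gnp_prob p [pred G : graph n | [exists i in I,
    (b <= #|D i (G :&: K)|)%N && [disjoint G & D i (G :&: K)]]] <= n%:R^-1.
Proof.
move=> In mb DK; apply: le_trans (gnp_prob_exists p01 _ _) _.
apply: le_trans (ler_sum _ (fun i _ => gnp_miss p01 b (DK i))) _.
rewrite sumr_const -[leLHS]mulr_natl; apply: le_inv; rewrite mulrA.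
apply: le_trans (_ : n%:R ^+ (4 * n) * q ^+ b <= _).
  rewrite ler_wpM2r ?exprn_ge0 // -natrX -natrM ler_nat.
  by rewrite -[(4 * n)%N]prednK ?muln_gt0 // expnS leq_mul2l In orbT.
apply: (pow_bound q_ge0 q_n).
apply: leq_trans (leq_mul (leqnn c) mb); rewrite mulnCA -mulnA leq_mul2l /=.
have h : (n * n <= 66 * m * (66 * m))%N by apply: leq_mul; move: m_ge n_m; clear; lia.
by apply: leq_trans h _; rewrite mulnACA leq_mul2r c_ge orbT.
Qed.

End Events.

(** * Pseudorandomness of the random graph *)

Lemma adj_subset n (G H : graph n) : G \subset H -> subrel (adj G) (adj H).
Proof.
move=> GH a b /existsP[d /andP[dG dE]]; apply/existsP; exists d.
by rewrite dE (subsetP GH).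
Qed.

Lemma adj_edge n (G : graph n) (a b : 'I_n) (d : edge n) : val d = [set a; b] -> adj G a b = (d \in G).
Proof.
move=> E; apply/existsP/idP => [[d' /andP[d'G /eqP E']]|dG]; last by exists d; rewrite dG E eqxx.
by rewrite (_ : d = d') //; apply: val_inj; rewrite E E'.
Qed.

(** * Boosters outside [V2] and their independence of the edges at [V2] *)

Section Sprinkling.
Variables (n : nat) (V2 : {set 'I_n}).

Definition touching : {set edge n} := [set d : edge n | ~~ (val d \subset ~: V2)].

(* A pair of equal vertices lists no edge and serves as padding. *)
Definition listed (t : seq ('I_n * 'I_n)) : {set edge n} :=
  [set d : edge n | has (fun p => val d == [set p.1; p.2]) t].

(** An index records the set to be covered, the two ends and the boosters added so far. The tuple
    has fixed length so that the indices form a finite type, as the union bound requires. *)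
Definition booster_edges (i : {set 'I_n} * 'I_n * 'I_n * n.-tuple ('I_n * 'I_n)) (H : graph n) :
    {set edge n} :=
  let: (W, x, y, t) := i in let e := adj (H :|: listed t) in
  [set d : edge n | (val d \subset ~: V2) && `[< exists2 s, longest W x y e s &
    exists2 p, val d = [set p.1; p.2] & booster W x y e (size s) p >]].

Lemma booster_edges_disjoint i H : [disjoint booster_edges i H & touching].
Proof.
case: i => [[[W x] y] t]; rewrite -setI_eq0; apply/eqP/setP => d.
by rewrite /booster_edges /touching !inE; case: (_ \subset _); rewrite ?andbF.
Qed.

(** An edge comes from at most two ordered pairs, told apart by which entry is smaller. *)
Lemma card_pairs (P : {set 'I_n * 'I_n}) (D : {set edge n}) :
  (forall p, p \in P -> p.1 != p.2 /\ forall d, val d = [set p.1; p.2] -> d \in D) ->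
  #|P| <= 2 * #|D|.
Proof.
move=> PD; pose f (p : 'I_n * 'I_n) := ([set p.1; p.2], p.1 < p.2).
have finj : {in P &, injective f}.
  move=> [a b] [a' b'] /PD[/= ab _] /PD[/= ab' _] [E L].
  have : a \in [set a'; b'] by rewrite -E !inE eqxx.
  have : b \in [set a'; b'] by rewrite -E !inE eqxx orbT.
  rewrite !inE => /orP[/eqP bE|/eqP bE] /orP[/eqP aE|/eqP aE]; subst a b => //.
  - by rewrite eqxx in ab.
  - by move: L ab'; rewrite -val_eqE /=; case: ltngtP.
  - by rewrite eqxx in ab.
rewrite -(card_in_imset finj).
apply: leq_trans (_ : #|setX (val @: D) [set: bool]| <= _); last first.
  by rewrite cardsX cardsT card_bool mulnC leq_mul2l leq_imset_card.
apply: subset_leq_card; apply/subsetP => -[A b] /imsetP[p pP [-> _]].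
have [pn pD] := PD p pP; rewrite in_setX in_setT andbT.
have h : #|[set p.1; p.2]| == 2 by rewrite cards2 pn.
apply/imsetP; exists (Sub [set p.1; p.2] h); last by rewrite SubK.
by apply: pD; rewrite SubK.
Qed.

Variables (G : graph n) (m K delta b : nat).
Hypothesis n_gt0 : 0 < n.
Hypothesis m_gt0 : 0 < m.
Hypothesis joint : forall A B : {set 'I_n}, [disjoint A & B] -> m <= #|A| -> m <= #|B| ->
  exists2 u, u \in A & exists2 w, w \in B & adj G u w.
Hypothesis exp2 : forall A : {set 'I_n}, 0 < #|A| <= m ->
  (#|A|).*2 + 3 + K <= #|[set z in V2 | (z \notin A) && [exists v in A, adj G v z]]|.
Hypothesis size1 : 3 * (3 * m + #|V2|) + 3 + m + delta <= n.
Hypothesis size2 : 3 * (3 * m + m) + 3 + m + K <= #|V2|.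
Hypothesis bm : b.*2 <= 3 * m * (3 * m).
Hypothesis sprinkle : forall i, b <= #|booster_edges i (G :&: touching)| ->
  ~~ [disjoint G & booster_edges i (G :&: touching)].

Lemma adj_touching a c : adj G a c -> (a \in V2) || (c \in V2) -> adj (G :&: touching) a c.
Proof.
case/existsP=> d /andP[dG dE] ac; apply/existsP; exists d; rewrite dE andbT !inE dG /=.
rewrite (eqP dE); apply/negP => /subsetP sub; have := sub a; have := sub c; rewrite !inE !eqxx orbT /=.
by move=> /(_ isT) /negbTE hc /(_ isT) /negbTE ha; rewrite hc ha in ac.
Qed.

(** Start from the edges touching [V2], which already expand, and add boosters of [G] outside [V2].
    At each stage there are at least [b] such edges, determined by an index and the starting graph,
    so [sprinkle] puts one of them in [G]. *)
Lemma hampath_random (W : {set 'I_n}) x y : x != y -> x \in W -> y \in W ->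
  #|V2 :\: W| <= K -> #|~: W| <= delta -> hampath W x y (adj G).
Proof.
move=> xy xW yW V2W dW; set H := G :&: touching.
apply: (@hampath_sprinkle _ W x y xy xW yW (adj G) (fun t => adj (H :|: listed t))).
- by move=> t; exact: adj_sym.
- move=> p t; apply: adj_subset; apply: setUS; apply/subsetP => d; rewrite !inE /= => ->.
  by rewrite orbT.
- move=> p t pn; have h : #|[set p.1; p.2]| == 2 by rewrite cards2 pn.
  rewrite (@adj_edge _ _ _ _ (Sub [set p.1; p.2] h)) ?SubK //.
  by rewrite !inE /= eqxx orbT.
- move=> t /allP tG a c /existsP[d /andP[+ /eqP dE]]; rewrite (adj_edge _ dE) inE.
  case/orP=> [/setIP[]//|]; rewrite inE => /hasP[p pt /eqP pE].
  by have := tG _ pt; rewrite (adj_edge _ pE).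
move=> t s tW at_ nham ls; set e := adj _ in nham ls *.
have tn : size t <= n by apply: leq_trans tW _; rewrite -[leqRHS]card_ord max_card.
(* Padding with [(x, x)] reaches length [n] and lists no further edge. *)
have sz : size (t ++ nseq (n - size t) (x, x)) == n by rewrite size_cat size_nseq subnKC.
have tE : listed (Tuple sz) = listed t.
  apply/setP => d; rewrite !inE /= has_cat has_nseq /=.
  case: (boolP (val d == [set x; x])) => [/eqP dE|]; last by rewrite andbF orbF.
  by have := valP d; rewrite /= dE setUid cards1.
pose i := (W, x, y, Tuple sz).
have D_E : booster_edges i H = [set d : edge n | (val d \subset ~: V2) && `[< exists2 s, longest W x y e s &
    exists2 p, val d = [set p.1; p.2] & booster W x y e (size s) p >]].
  by rewrite /booster_edges /i tE.
have esym : symmetric e by exact: adj_sym.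
have sub : subrel (adj H) e by apply: adj_subset; exact: subsetUl.
have joint1 : forall A B : {set 'I_n}, [disjoint A & B] -> m <= #|A| -> m <= #|B| ->
    (A \subset V2) || (B \subset V2) -> exists2 a, a \in A & exists2 c, c \in B & adj H a c.
  move=> A B dAB mA mB AB; have [a aA [c cB ac]] := joint dAB mA mB.
  exists a => //; exists c => //; apply: adj_touching => //.
  by case/orP: AB => /subsetP h; [rewrite (h _ aA)|rewrite (h _ cB) orbT].
have exp2' (A : {set 'I_n}) : 0 < #|A| <= m ->
    (#|A|).*2 + 3 + K <= #|[set z in V2 | (z \notin A) && [exists v in A, adj H v z]]|.
  move=> /exp2 h; apply: leq_trans h (subset_leq_card _); apply/subsetP => z.
  rewrite !inE => /and3P[zV -> /exists_inP[v vA vz]]; rewrite zV /=.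
  by apply/exists_inP; exists v => //; apply: adj_touching; rewrite // zV orbT.
have size1' : 3 * (3 * m + #|V2|) + 3 + m + delta <= #|'I_n| by rewrite card_ord.
have cP := booster_count xy esym (connected_in esym sub m_gt0 joint1 exp2' V2W dW size1' size2)
  (ends_large sub m_gt0 joint1 exp2' V2W dW size1' size2) ls.
have cD : b <= #|booster_edges i H|.
  rewrite -leq_double; apply: leq_trans (leq_trans bm cP) _.
  rewrite -mul2n; apply: card_pairs => p; rewrite inE => /and3P[p1 p2 /asboolP pB].
  split; first by case: pB.
  move=> d dE; rewrite D_E inE dE subUset !sub1set p1 p2 /=.
  by apply/asboolP; exists s => //; exists p.
have := sprinkle cD; rewrite -setI_eq0 => /set0Pn[d]; rewrite D_E !inE.
case/and3P=> dG _ /asboolP[s' ls' [p dE pB]]; exists p; first by rewrite (adj_edge _ dE).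
suff -> : size s = size s' by [].
by apply/eqP; rewrite eqn_leq; case: ls ls' => fs ms [fs' ms']; rewrite ms' // ms.
Qed.

End Sprinkling.

(** A set of at most [K + 2] vertices expands by the degree of a single member. For a larger [A], a
    violation gives [#|Z| < 3 #|A|], and then no edge leads from [A] to [S] outside [A :|: Z]. *)
Lemma expansion_of (n : nat) (G : graph n) (S : {set 'I_n}) (m K : nat) :
  (forall v, 4 * K + 8 < #|[set w in S | adj G v w]|) ->
  (forall A Y : {set 'I_n}, 0 < #|A| <= m -> A \subset Y -> #|Y| <= 4 * #|A| ->
    ~~ [disjoint G & between A (S :\: Y)]) ->
  forall A : {set 'I_n}, 0 < #|A| <= m ->
    (#|A|).*2 + 3 + K <= #|[set z in S | (z \notin A) && [exists v in A, adj G v z]]|.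
Proof.
move=> deg expand A /andP[A0 Am]; set Z := [set z in S | _].
have [AK|AK] := leqP #|A| (K + 2).
  have [v vA] : exists v, v \in A by apply/set0Pn; rewrite -card_gt0.
  have sub : [set w in S | adj G v w] \subset Z :|: A.
    apply/subsetP => w; rewrite !inE => /andP[wS vw]; rewrite wS /=.
    by case: (w \in A) => //=; rewrite orbF; apply/exists_inP; exists v.
  have := leq_trans (deg v) (leq_trans (subset_leq_card sub) (leq_card_setU _ _)).
  by move: AK; clear; set a := #|A|; set z := #|Z|; lia.
rewrite leqNgt; apply/negP => Zlt.
have ZA : #|A :|: Z| <= 4 * #|A|.
  apply: leq_trans (leq_card_setU _ _) _.
  by move: AK Zlt; clear; set a := #|A|; set z := #|Z|; lia.
have := expand A (A :|: Z); rewrite A0 Am subsetUl => /(_ isT isT ZA) /betweenP[a aA [w]].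
rewrite !inE negb_or => /andP[/andP[wA + wS] aw]; rewrite wS wA /=.
by move/negP; apply; apply/exists_inP; exists a.
Qed.

(** This puts the number of vertices used by a cycle and its rungs below [m]; the threshold 11 is
    the source of [2 ^ 11 <= m]. *)
Lemma poly_le_exp l : 11 <= l -> 8 * l + 12 + (3 * l + 3) * (l + l) <= 2 ^ l.-1.
Proof.
case: l => [|l] //; rewrite ltnS => l10; rewrite [l.+1.-1]/=.
have -> : l = 10 + (l - 10) by lia.
elim: (l - 10) => [|k IH]; first by [].
rewrite addnS expnS; move: IH; set z := 2 ^ _ => IH; nia.
Qed.

Lemma card_initial n k : k <= n -> #|[set i : 'I_n | i < k]| = k.
Proof.
move=> kn; rewrite cardsE -sum1_card.
rewrite (eq_bigl (fun i : 'I_n => i < k)) //.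
by rewrite -(big_ord_widen n (fun=> 1) kn) sum1_card card_ord.
Qed.

(** * Choice of parameters and the total failure probability *)

Section Assembly.
Variable n : nat.
(** [m] is linear in [n], and [l] is the depth at which a binary tree has at least [m] leaves. [K]
    covers the [8 l + 10] forbidden vertices of a short path and its two ends. *)
Let m := n %/ 64.
Let l := up_log 2 m.
Let K := 8 * l + 12.
Let V2 : {set 'I_n} := [set i : 'I_n | i < n %/ 4].
Hypothesis n_large : 2 ^ 11 <= m.

Let m_gt : 2047 < m. Proof. exact: n_large. Qed.
Let n_m : 64 * m <= n < 64 * m + 64.
Proof. by rewrite /m; have := divn_eq n 64; have := @ltn_pmod n 64 isT; lia. Qed.
Let cV2 : #|V2| = n %/ 4. Proof. by apply: card_initial; exact: leq_div. Qed.
Let n4 : 4 * (n %/ 4) <= n < 4 * (n %/ 4) + 4.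
Proof. by have := divn_eq n 4; have := @ltn_pmod n 4 isT; lia. Qed.
Let cV1 : #|~: V2| = n - n %/ 4. Proof. by rewrite cardsCs setCK cV2 card_ord. Qed.

Let l_bounds : 2 ^ l.-1 < m <= 2 ^ l.
Proof. by apply: up_log_bounds => //; apply: leq_ltn_trans m_gt. Qed.

Let l_ge : 11 <= l.
Proof.
rewrite -(@leq_exp2l 2) //; apply: leq_trans n_large _; by case/andP: l_bounds.
Qed.

Let l2m : 2 ^ l < 2 * m.
Proof. by rewrite -[l]prednK ?expnS ?ltn_pmul2l //; [case/andP: l_bounds|apply: leq_trans l_ge]. Qed.

Let delta := K + (3 * l + 3) * (l + l).
Let delta_m : delta < m.
Proof. by apply: leq_ltn_trans (poly_le_exp l_ge) _; case/andP: l_bounds. Qed.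

Definition bad_degree (S : {set 'I_n}) : pred (graph n) :=
  [pred G : graph n | [exists v in 'I_n, #|[set w in S | adj G v w]| <= 4 * K + 8]].

Definition bad_expansion (S : {set 'I_n}) : pred (graph n) :=
  [pred G : graph n | [exists AY : {set 'I_n} * {set 'I_n} in
      [pred AY : {set 'I_n} * {set 'I_n} |
        [&& 0 < #|AY.1| <= m, AY.1 \subset AY.2 & #|AY.2| <= 4 * #|AY.1|]],
      [disjoint G & between AY.1 (S :\: AY.2)]]].

Definition bad_joint : pred (graph n) :=
  [pred G : graph n | [exists AB : {set 'I_n} * {set 'I_n} in
      [pred AB : {set 'I_n} * {set 'I_n} |
        [&& [disjoint AB.1 & AB.2], m <= #|AB.1| & m <= #|AB.2|]],
      [disjoint G & between AB.1 AB.2]]].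

Definition booster_index : finType :=
  ({set 'I_n} * 'I_n * 'I_n * n.-tuple ('I_n * 'I_n))%type.

Definition bad_sprinkle : pred (graph n) :=
  [pred G : graph n | [exists i in booster_index,
    (4 * (m * m) <= #|booster_edges V2 i (G :&: touching V2)|) &&
    [disjoint G & booster_edges V2 i (G :&: touching V2)]]].

Lemma not_bad_full (G : graph n) : odd n ->
  ~~ bad_degree V2 G -> ~~ bad_degree (~: V2) G ->
  ~~ bad_expansion V2 G -> ~~ bad_expansion (~: V2) G ->
  ~~ bad_joint G -> ~~ bad_sprinkle G -> kcycle_space n G == cycle_space G.
Proof.
move=> n_odd d2 d1 e2 e1 j s.
have degP S : ~~ bad_degree S G -> forall v, 4 * K + 8 < #|[set w in S | adj G v w]|.
  by move=> /exists_inPn h v; rewrite ltnNge; exact: h.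
have expP S : ~~ bad_expansion S G -> forall A Y : {set 'I_n}, 0 < #|A| <= m -> A \subset Y ->
    #|Y| <= 4 * #|A| -> ~~ [disjoint G & between A (S :\: Y)].
  move=> /exists_inPn h A Y A0 AY YA; apply: (h (A, Y)). by apply/and3P; split.
have E2 := expansion_of (degP _ d2) (expP _ e2).
have E1 := expansion_of (degP _ d1) (expP _ e1).
have joint : forall A B : {set 'I_n}, [disjoint A & B] -> m <= #|A| -> m <= #|B| ->
    exists2 u, u \in A & exists2 w, w \in B & adj G u w.
  move=> A B dAB mA mB; apply: betweenP; move/exists_inPn: j => /(_ (A, B)); apply.
  by apply/and3P; split.
have m0 : 0 < m by apply: leq_trans m_gt.
have sP i : 4 * (m * m) <= #|booster_edges V2 i (G :&: touching V2)| ->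
    ~~ [disjoint G & booster_edges V2 i (G :&: touching V2)].
  by move=> mb; move/exists_inPn: s => /(_ i isT); rewrite mb.
apply: (@kcycle_space_full n G V2 m l K delta
  (K + (3 * l + 3) * (l + l) + 2 ^ l.+1 + 2 ^ l.+2)) => //.
- by move: m_gt n_m; clear; lia.
- exact: leq_trans l_ge.
- by case/andP: l_bounds.
(* Since [delta < m] and [2 ^ l < 2 m], the budget is below [13 m], while about [48 m] vertices lie
   outside [V2]. *)
- rewrite -/delta cV1 !expnS; move: delta_m l2m n_m n4 m_gt; clear.
  by set d := delta; set z := 2 ^ l; lia.
- move=> U U0; apply: leq_trans (_ : #|U|.*2 + 3 + K <= _).
    by rewrite leq_add2r leq_addr.
  apply: leq_trans (E1 U U0) _; apply: subset_leq_card; apply/subsetP => z.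
  rewrite inE => /and3P[zV _ /exists_inP[u uU uz]]; apply/bigcupP; exists u => //.
  by rewrite inE zV.
move=> W x y xy xW yW V2W dW.
(* With [3m] ends on either side there are [9 m^2] ordered pairs, hence at least [4 m^2] edges. *)
apply: (@hampath_random n V2 G m K delta (4 * (m * m))) => //.
- rewrite cV2; move: delta_m n_m n4 m_gt; clear; set d := delta; lia.
- rewrite cV2; move: (leq_ltn_trans (leq_addr _ _) delta_m : K < m) n_m n4 m_gt; clear.
  set k := K; lia.
- by rewrite -mul2n; clear; nia.
Qed.

Local Open Scope ring_scope.
Variables (R : realType) (p : R) (c c' : nat).
Hypothesis p01 : 0 <= p <= 1.
Hypothesis q_n : n%:R ^+ c * (1 - p) ^+ n <= 1.
Hypothesis q'_n : n%:R ^+ c' * (1 - p / 2) ^+ n <= 1.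
Hypothesis c_ge : (66 * 66 <= c)%N.
Hypothesis c'_ge : (800 <= c')%N.

Lemma prob_full : odd n ->
  1 - 6 / n%:R <= gnp_prob p [pred G : graph n | kcycle_space n G == cycle_space G].
Proof.
move=> n_odd.
pose bad := [pred G | bad_degree V2 G || [pred G | bad_degree (~: V2) G ||
  [pred G | bad_expansion V2 G || [pred G | bad_expansion (~: V2) G ||
  [pred G : graph n | bad_joint G || bad_sprinkle G] G] G] G] G].
apply: le_trans (_ : gnp_prob p (predC bad) <= _); last first.
  apply: gnp_prob_le => // G; rewrite !inE !negb_or => /and5P[d2 d1 e2 e1 /andP[j s]].
  exact: not_bad_full.
rewrite -[leRHS](subKr 1) -gnp_probC lerB //.
have m64 : (64 <= m)%N by apply: leq_trans m_gt.
have nm' : (64 * m <= n <= 65 * m)%N by move: n_m m64; clear; lia.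
(* [2 ^ (32 l)] is at most [n ^ 32] because [2 ^ l < 2 m], and [2 ^ 56] is at most [n ^ 56]. *)
have s_n : (2 ^ (4 * K + 8) <= n ^ 88)%N.
  have -> : (4 * K + 8 = l * 32 + 56)%N by rewrite /K; clear; lia.
  rewrite expnD (_ : 88 = 32 + 56)%N // expnD expnM leq_mul // leq_exp2r //.
    by apply: leq_trans (ltnW l2m) _; move: nm'; clear; lia.
  by move: nm' m64; clear; lia.
have S2 : (16 * m <= #|V2|)%N by rewrite cV2; move: n4 n_m; clear; lia.
have S1 : (16 * m <= #|~: V2|)%N by rewrite cV1; move: n4 n_m; clear; lia.
have h1 := prob_low_degree p01 m64 nm' q'_n c'_ge S2 s_n.
have h2 := prob_low_degree p01 m64 nm' q'_n c'_ge S1 s_n.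
have h3 := prob_no_expansion p01 m64 nm' q_n c_ge S2.
have h4 := prob_no_expansion p01 m64 nm' q_n c_ge S1.
have h5 := prob_not_joint p01 m64 nm' q_n c_ge.
have h6 : gnp_prob p bad_sprinkle <= n%:R^-1.
  apply: (prob_no_sprinkle p01 m64 nm' q_n c_ge) => //; last first.
    by move=> i H; exact: booster_edges_disjoint.
  rewrite !card_prod card_sets card_tuple card_prod !card_ord.
  (* The indices number at most [n ^ (3 n + 2)], and [3 n + 2 <= 4 n - 1] once [n] is at least
     three. *)
  have n0 : (2 < n)%N by move: nm' m64; clear; lia.
  apply: leq_trans (_ : n ^ n * n * n * (n * n) ^ n <= _)%N.
    by rewrite !leq_mul // leq_exp2r ?(ltnW n0) //; do 2 apply: ltnW.
  rewrite expnMn -!expnSr -!expnD leq_exp2l //; move: n0; clear; lia.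
apply: le_trans (gnp_probU p01 _ _) _; rewrite (_ : 6 / n%:R = n%:R^-1 + (n%:R^-1 + (n%:R^-1 +
  (n%:R^-1 + (n%:R^-1 + n%:R^-1))))); last first.
  by rewrite [LHS]mulr_natl !mulrS mulr0n addr0.
apply: lerD => //; apply: le_trans (gnp_probU p01 _ _) _.
apply: lerD => //; apply: le_trans (gnp_probU p01 _ _) _.
apply: lerD => //; apply: le_trans (gnp_probU p01 _ _) _.
by apply: lerD => //; apply: le_trans (gnp_probU p01 _ _) _; apply: lerD.
Qed.

End Assembly.

(* Exponential decay and the limit *)
From mathcomp Require Import all_classical all_reals all_analysis.
Import numFieldNormedType.Exports.
Local Open Scope classical_set_scope.
Local Open Scope ring_scope.

(** From [1 - x <= expR (- x)]. *)
Lemma power_decay (R : realType) (n c : nat) (x : R) : (0 < n)%N -> 0 <= x <= 1 ->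
  c%:R * ln n%:R <= x * n%:R -> n%:R ^+ c * (1 - x) ^+ n <= 1.
Proof.
move=> n0 /andP[x0 x1] h.
have nR : (n%:R : R) = expR (ln n%:R) by rewrite lnK // posrE ltr0n.
rewrite [in X in X ^+ c]nR -expRM_natl.
apply: le_trans (_ : expR (c%:R * ln n%:R) * expR (- x) ^+ n <= _).
  apply: ler_wpM2l; first exact: expR_ge0.
  by apply: lerXn2r; rewrite ?nnegrE ?subr_ge0 ?expR_ge0 // expR_ge1Dx.
rewrite -expRM_natl -expRD -[leRHS]expR0 ler_expR.
by rewrite mulrN subr_le0 [X in _ <= X]mulrC.
Qed.

Theorem corollary1p6 (R : realType) :
  exists C : R, 1 < C /\
    forall p : nat -> R,
      (forall n : nat, 0 <= p n <= 1) ->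
      (\forall n \near \oo, C * ln (n%:R : R) / n%:R <= p n) ->
      gnp_prob (p n) [pred G : graph n | kcycle_space n G == cycle_space G]
        @[n --> within [set n : nat | odd n] \oo] --> (1 : R).
Proof.
(* The factor two compensates for the [p / 2] in the lower-tail bound for degrees. *)
pose c' := (66 * 66)%N; exists (c' * 2)%:R; split; first by rewrite ltr1n.
move=> p p01 p_ge; apply/cvgrPdist_le => eps eps0.
rewrite near_withinE; near=> n => n_odd.
have n0 : (0 < n)%N by rewrite odd_gt0.
have n_large : (2 ^ 11 <= n %/ 64)%N.
  rewrite leq_divRL //; near: n; exact: nbhs_infty_ge.
have pn : (c' * 2)%:R * ln n%:R <= p n * n%:R.
  by rewrite -ler_pdivrMr ?ltr0n //; near: n.
have [p0 p1] := andP (p01 n).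
have p2 : 0 <= p n / 2 <= 1.
  rewrite divr_ge0 //= ler_pdivrMr // mul1r; apply: le_trans p1 _; by rewrite ler1n.
have h := prob_full n_large (p01 n) (power_decay n0 (p01 n) pn)
  (power_decay (c := c') n0 p2 _) _ _ n_odd.
rewrite ger0_norm ?subr_ge0 ?gnp_prob_le1 // lerBlDr -lerBlDl.
apply: le_trans (h _ _ _); rewrite //.
- rewrite lerB // ler_pdivrMr ?ltr0n // -ler_pdivrMl // mulrC.
  near: n; exact: nbhs_infty_ger.
- rewrite mulrAC ler_pdivlMr // mulrAC -natrM.
  exact: pn.
Unshelve. all: by end_near.
Qed.
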